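(* Let $p\in\,]0,1[$ be a constant. The expected rumor spreading time of the push-pull protocol with success probability $p$ on the complete graph with $n$ vertices is equal to $$\log_{2p+1} n+\frac{1}{p+\ln\frac1{1-p}}\ln n\pm O(1).$$
   Context: Push-pull protocol with success probability $p$ on the complete graph with $n$ nodes: initially exactly one node is informed. In each round, every node (informed or not) calls a node chosen independently and uniformly at random from all $n$ nodes (including itself); each call independently is successful with probability $p$ and otherwise has no effect. If a call is successful and one of caller and called node was informed at the beginning of the round, then both are informed from the end of that round on. The rumor spreading time is the number of rounds until all nodes are informed. $\pm O(1)$ denotes a deviation bounded in absolute value by a constant independent of $n$ (possibly depending on $p$), for all sufficiently large $n$. *)

(* Defs.v *)
From mathcomp Require Import all_boot all_order all_algebra.
From mathcomp Require Import all_classical all_reals all_analysis.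
Set Implicit Arguments.
Unset Strict Implicit.
Unset Printing Implicit Defensive.
Import Order.TTheory GRing.Theory Num.Theory.
Local Open Scope ring_scope.
Local Open Scope classical_set_scope.

(* Mutual independence of a family of finitely-valued random variables; each
   value type carries the discrete sigma-algebra, so that A ranges over all
   families of subsets. *)
Definition mutually_independent (d : measure_display) (Omega : measurableType d)
    (R : realType) (P : probability Omega R) (I : choiceType) (V : I -> finType)
    (X : forall k : I, Omega -> V k) : Prop :=
  forall (s : seq I) (A : forall k : I, set (V k)), uniq s ->
    P (\bigcap_(k in [set` s]) (X k @^-1` A k)) =
    (\prod_(k <- s) P (X k @^-1` A k))%E.

Section PushPull.
Variable n : nat.

(* Node u calls the node [c u], and this call is successful iff [b u]. *)
Definition push_pull_step (c : 'I_n -> 'I_n) (b : 'I_n -> bool)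
    (S : {set 'I_n}) : {set 'I_n} :=
  [set v | (v \in S) ||
     [exists u, [&& b u, (u \in S) || (c u \in S) & (v == u) || (v == c u)]]]%SET.

Fixpoint informed (c : nat -> 'I_n -> 'I_n) (b : nat -> 'I_n -> bool)
    (x0 : 'I_n) (t : nat) : {set 'I_n} :=
  if t is t'.+1 then push_pull_step (c t') (b t') (informed c b x0 t')
  else [set x0]%SET.

(* [draw] merges the two families into one, indexed by a sum type, so that
   called nodes and successes are required to be jointly independent. *)
Definition draw_value (k : nat * 'I_n + nat * 'I_n) : finType :=
  match k with inl _ => 'I_n | inr _ => bool end.

Definition draw (Omega : Type) (call : nat -> 'I_n -> Omega -> 'I_n)
    (succ : nat -> 'I_n -> Omega -> bool) (k : nat * 'I_n + nat * 'I_n) :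
    Omega -> draw_value k :=
  match k with
  | inl ti => call ti.1 ti.2
  | inr ti => succ ti.1 ti.2
  end.

(* [call t i] is the node called by i in round t, [succ t i] the success of that
   call; the first round is round 0. *)
Record push_pull_calls (d : measure_display) (Omega : measurableType d)
    (R : realType) (P : probability Omega R) (p : R)
    (call : nat -> 'I_n -> Omega -> 'I_n)
    (succ : nat -> 'I_n -> Omega -> bool) : Prop := {
  measurable_call : forall t i j, measurable (call t i @^-1` [set j]);
  measurable_succ : forall t i, measurable (succ t i @^-1` [set true]);
  call_uniform : forall t i j, P (call t i @^-1` [set j]) = (n%:R^-1)%:E;
  succ_bernoulli : forall t i, P (succ t i @^-1` [set true]) = p%:E;
  draws_independent : mutually_independent P (draw call succ)
}.

(* The value is +oo if some node is never informed. *)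
Definition spreading_time (R : realType) (Omega : Type)
    (call : nat -> 'I_n -> Omega -> 'I_n)
    (succ : nat -> 'I_n -> Omega -> bool) (x0 : 'I_n) (w : Omega) : \bar R :=
  ereal_inf [set (t%:R)%:E | t in
    [set t : nat | informed (fun t i => call t i w) (fun t i => succ t i w) x0 t
                   = [set: 'I_n]%SET]].

End PushPull.

(* Main.v *)
(* Drift argument.  Let k nodes be informed, u = n - k, x = k / n, and let Y be
   the number of nodes still uninformed one round later.  Revealing the calls
   of the uninformed nodes first, then those of the informed ones, gives
     E Y = u (1 - p x) (1 - p/n)^k,  E (u - Y)^2 <= (2pk)^2 + 2pk,
     E 1/(Y+1) <= (1 + p/n)^k / ((1 - p x) (u + 1)).
   With A = 1 / ln (2p+1) and B = 1 / (p - ln (1-p)), the potential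
   A ln (n/k) + B ln (u+1) decreases by 1 per round up to O(x (1-x)): by Jensen's
   inequality the bounds on E Y and E 1/(Y+1) suffice for the lower bound on
   its expectation, and for the upper bound the fluctuations cost a further
   O(1/k) while x <= 1/2 and O(1/u) afterwards.  These errors are absorbed by
   the bounded corrections u/n, 1/k and 1/(u+1): the expected decrease of u/n
   is at least p x (1-x), and those of 1/k and -1/(u+1) are at least constant
   multiples of 1/k and 1/(u+1) in the respective phases.  Hence
   the expected time differs from (A + B) ln n by at most a constant. *)
Require Import Defs.
From mathcomp Require Import all_boot all_order all_algebra.
From mathcomp Require Import all_classical all_reals all_analysis.
From mathcomp Require Import measurable_realfun ring lra.
Set Implicit Arguments.
Unset Strict Implicit.
Unset Printing Implicit Defensive.
Import Order.TTheory GRing.Theory Num.Theory.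
Local Open Scope ring_scope.

(** * One round, processed caller by caller *)

Section Round.
Variables (R : realType) (p : R) (n : nat).

Let outcome := {ffun 'I_n -> 'I_n * bool}.

Definition call_weight (t : 'I_n * bool) : R :=
  n%:R^-1 * (if t.2 then p else 1 - p).

Definition round_weight (D : outcome) : R := \prod_i call_weight (D i).

Definition round_mean (G : outcome -> R) : R := \sum_D round_weight D * G D.

Lemma sum_call_weight (F : 'I_n * bool -> R) :
  \sum_t call_weight t * F t =
  n%:R^-1 * \sum_j (p * F (j, true) + (1 - p) * F (j, false)).
Proof.
rewrite (eq_bigr (fun t => call_weight (t.1, t.2) * F (t.1, t.2))); last by case.
rewrite -(pair_bigA _ (fun j b => call_weight (j, b) * F (j, b))) /= mulr_sumr.
apply: eq_bigr => j _; rewrite big_bool /call_weight /=; ring.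
Qed.

Lemma call_weight1 : (0 < n)%N -> \sum_t call_weight t = 1.
Proof.
move=> n0; under eq_bigr do rewrite -[call_weight _]mulr1.
rewrite sum_call_weight.
under eq_bigr do rewrite !mulr1 addrC subrK.
by rewrite sumr_const card_ord mulVf // pnatr_eq0 -lt0n.
Qed.

Lemma round_weight1 : (0 < n)%N -> \sum_D round_weight D = 1.
Proof.
move=> n0; rewrite /round_weight -(bigA_distr_bigA (fun _ => call_weight)) /=.
by rewrite big1 // => i _; exact: call_weight1.
Qed.

Definition override (D : outcome) i t : outcome :=
  [ffun j => if j == i then t else D j].

(** Swapping the draw of [i] with an independent fresh draw is a weight-preserving involution on
    pairs (draw, outcome), so redrawing one coordinate leaves the mean unchanged. *)
Lemma round_mean_resample (G : outcome -> R) i :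
  round_mean G = \sum_t call_weight t * round_mean (fun D => G (override D i t)).
Proof.
have n0 : (0 < n)%N by case: i => m; exact: leq_ltn_trans.
pose h (s : ('I_n * bool) * outcome) := (s.2 i, override s.2 i s.1).
have hK : involutive h.
  move=> [t D]; rewrite /h /= /override !ffunE eqxx; congr pair.
  by apply/ffunP => j; rewrite !ffunE; case: eqP => // ->.
under [RHS]eq_bigr do rewrite mulr_sumr.
rewrite pair_bigA /= (reindex_inj (inv_inj hK)) /=.
rewrite /round_mean -[LHS]mul1r -(call_weight1 n0) big_distrlr /= pair_bigA /=.
apply: eq_bigr => -[t D] _ /=.
have -> : override (override D i t) i (D i) = D.
  by apply/ffunP => j; rewrite !ffunE; case: eqP => // ->.
rewrite !mulrA; congr (_ * _).
rewrite /round_weight (bigD1 i) //= [in RHS](bigD1 i) //= !ffunE eqxx.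
rewrite mulrCA; congr (_ * (_ * _)).
by apply: eq_bigr => j /negbTE; rewrite !ffunE => ->.
Qed.

Section Step.
Variable S : {set 'I_n}.

(** [S] stays frozen at its value at the start of the round while [V] accumulates the informed
    nodes; hence the calls of a round may be processed in any order. *)
Definition call_update (V : {set 'I_n}) (i : 'I_n) (t : 'I_n * bool) : {set 'I_n} :=
  if t.2 && ((i \in S) || (t.1 \in S)) then (i |: (t.1 |: V))%SET else V.

Definition calls_update (D : outcome) (V : {set 'I_n}) (l : seq 'I_n) :=
  foldl (fun V i => call_update V i (D i)) V l.

Lemma in_calls_update D V l v :
  (v \in calls_update D V l) = (v \in V) ||
    has (fun i => [&& (D i).2, (i \in S) || ((D i).1 \in S)
                    & (v == i) || (v == (D i).1)]) l.
Proof.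
elim: l V => [|i l IH] V /=; first by rewrite orbF.
rewrite -/(calls_update D _ l) IH /call_update andbA.
by case: ifP => _ /=; rewrite ?inE ?orbA //; case: (v \in V); rewrite /= ?orbT ?orbF.
Qed.

Definition step (D : outcome) (S : {set 'I_n}) :=
  push_pull_step (fun i => (D i).1) (fun i => (D i).2) S.

Lemma step_calls_update D l :
  (forall i, i \in l) -> step D S = calls_update D S l.
Proof.
move=> lT; apply/setP => v; rewrite in_calls_update inE; congr (_ || _).
apply/existsP/hasP => [[i Hi]|[i _ Hi]]; first by exists i.
by exists i.
Qed.

(** The calls in [l] do not read the draw of [i], so that draw can be averaged separately from the
    others. *)
Lemma round_mean_calls_cons (G : {set 'I_n} -> R) V i l : i \notin l ->
  round_mean (fun D => G (calls_update D V (i :: l))) =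
  \sum_t call_weight t *
    round_mean (fun D => G (calls_update D (call_update V i t) l)).
Proof.
move=> il; rewrite (round_mean_resample _ i); apply: eq_bigr => t _.
congr (_ * _); apply: eq_bigr => D _; congr (_ * G _).
rewrite /= ffunE eqxx; set W := call_update _ _ _.
elim: l W il => //= j l IH W; rewrite inE negb_or => /andP[ij jl].
by rewrite ffunE eq_sym (negbTE ij) IH.
Qed.

(* [push_op g z] is the mean of g at the number of uninformed nodes after the
   call of one informed node, when there were z of them; [bin_op q a g s] is the
   mean of g at s + X for X binomial with parameters a and q. *)
Definition push_op (g : nat -> R) (z : nat) : R :=
  (1 - p * z%:R / n%:R) * g z + p * z%:R / n%:R * g z.-1.

Fixpoint bin_op (q : R) (a : nat) (g : nat -> R) (s : nat) : R :=
  if a is a'.+1 then q * bin_op q a' g s.+1 + (1 - q) * bin_op q a' g s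
  else g s.

(** An informed caller already lies in [V], so its call matters only through the called node: with z
    nodes uninformed, one of them is informed with probability p z / n. The count of uninformed
    nodes is thus itself a Markov chain, with transition operator [push_op]. *)
Lemma round_mean_push (g : nat -> R) (V : {set 'I_n}) l : uniq l -> {subset l <= S} ->
  S \subset V -> (0 < n)%N ->
  round_mean (fun D => g #|~: calls_update D V l|%SET) =
  iter (size l) push_op g #|~: V|%SET.
Proof.
move=> + + + n0; elim: l V => [|i l IH] V /=.
  by move=> _ _ _; rewrite /round_mean -mulr_suml round_weight1 // mul1r.
move=> /andP[il ul] lS SV.
have iS : i \in S by apply: lS; rewrite inE eqxx.
have iV : i \in V by exact: (fintype.subsetP SV).
rewrite (round_mean_calls_cons (fun W => g #|~: W|%SET)) // sum_call_weight.
have lS' : {subset l <= S} by move=> j jl; apply: lS; rewrite inE jl orbT.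
set F := iter (size l) push_op g.
have E j : round_mean (fun D => g #|~: calls_update D (call_update V i (j, true)) l|%SET) =
    if j \in ~: V then F #|~: V|.-1%SET else F #|~: V|%SET.
  rewrite IH //; last first.
    rewrite /call_update /= iS /=; apply: (fintype.subset_trans SV).
    by apply/fintype.subsetP => w wV; rewrite !inE wV !orbT.
  rewrite /call_update /= iS /=.
  have -> : (i |: (j |: V) = j |: V)%SET.
    by apply/finset.setUidPr; rewrite finset.sub1set !inE iV orbT.
  rewrite inE; case: ifPn; last first.
    by rewrite negbK => jV; congr F; rewrite (finset.setUidPr _) // finset.sub1set.
  move=> jV; congr F; rewrite finset.setCU finset.setIC -finset.setDE.
  by rewrite [in RHS](cardsD1 j) inE jV.
under eq_bigr => j _ do rewrite E /call_update /= IH // -/F.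
rewrite big_split /= sumr_const card_ord -mulr_sumr (bigID (mem (~: V)%SET)) /=.
rewrite (eq_bigr (fun=> F #|~: V|.-1%SET)); last by move=> j ->.
rewrite sumr_const (eq_bigr (fun=> F #|~: V|%SET)); last by move=> j /negbTE ->.
rewrite sumr_const /push_op -[(_ *+ n)]mulr_natl.
have nE : (#|[predC ~: V]%SET|%:R : R) = n%:R - #|~: V|%SET%:R.
  by rewrite -[in n%:R](card_ord n) -(cardC (~: V)%SET) natrD addrAC subrr add0r.
rewrite -[_ *+ #|[predC ~: V]%SET|]mulr_natl nE -mulr_natl.
by field; rewrite pnatr_eq0 -lt0n.
Qed.

(** An uninformed caller is informed by its own call exactly when the call succeeds and hits [S],
    and then the called node is already in [V]. So each caller in [l] independently stays uninformed
    with probability 1 - p |S| / n, which gives the binomial layer; in the induction [s] counts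
    those that have stayed uninformed so far. *)
Lemma round_mean_pull_push (g : nat -> R) (V : {set 'I_n}) l s : uniq l ->
  {in l, forall i, i \notin V} -> S \subset V -> (0 < n)%N ->
  #|~: V|%SET = (size l + s)%N ->
  round_mean (fun D => g #|~: calls_update D V (l ++ enum S)|%SET) =
  bin_op (1 - p * #|S|%:R / n%:R) (size l) (iter #|S| push_op g) s.
Proof.
move=> + + + n0; elim: l V s => [|i l IH] V s /=.
  move=> _ _ SV Vs; rewrite round_mean_push ?enum_uniq // ?Vs ?cardE //.
  by move=> j; rewrite mem_enum.
move=> /andP[il ul] lV SV Vs.
have iV : i \notin V by apply: lV; rewrite inE eqxx.
have iS : i \notin S by apply: contra iV => /(fintype.subsetP SV).
rewrite (round_mean_calls_cons (fun W => g #|~: W|%SET)); last first.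
  by rewrite mem_cat mem_enum negb_or il.
have lV' : {in l, forall j, j \notin V} by move=> j jl; apply: lV; rewrite inE jl orbT.
set q := 1 - _; set F := bin_op q (size l) (iter #|S| push_op g).
have E0 : round_mean (fun D => g #|~: calls_update D V (l ++ enum S)|%SET) = F s.+1.
  by apply: IH => //; rewrite Vs addnS addSn.
have E j : round_mean (fun D =>
      g #|~: calls_update D (call_update V i (j, true)) (l ++ enum S)|%SET) =
    if j \in S then F s else F s.+1.
  rewrite /call_update /= (negbTE iS) /=; case: ifPn => jS; last exact: E0.
  have -> : (i |: (j |: V) = i |: V)%SET.
    have jV : j \in V by exact: (fintype.subsetP SV).
    by rewrite (finset.setUidPr (_ : [set j] \subset V)%SET) // finset.sub1set.
  apply: IH => //.
  - move=> w wl; rewrite !inE negb_or lV' // andbT.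
    by apply: contraNneq il => <-.
  - by apply: (fintype.subset_trans SV); exact: finset.subsetUr.
  - apply/eqP; rewrite -eqSS -addSn -Vs (cardsD1 i (~: V)%SET) inE iV add1n.
    by rewrite finset.setCU finset.setIC -finset.setDE.
rewrite sum_call_weight.
under eq_bigr => j _ do rewrite E /call_update /= E0.
rewrite big_split /= sumr_const card_ord -mulr_sumr (bigID (mem S)) /=.
rewrite (eq_bigr (fun=> F s)); last by move=> j ->.
rewrite sumr_const (eq_bigr (fun=> F s.+1)); last by move=> j /negbTE ->.
rewrite sumr_const -[(_ *+ n)]mulr_natl.
have nE : (#|[predC S]|%:R : R) = n%:R - #|S|%:R.
  by rewrite -[in n%:R](card_ord n) -(cardC S) natrD addrAC subrr add0r.
rewrite -[_ *+ #|[predC S]|]mulr_natl nE -mulr_natl /q.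
by field; rewrite pnatr_eq0 -lt0n.
Qed.

Lemma round_mean_uninformed (g : nat -> R) : (0 < n)%N ->
  round_mean (fun D => g #|~: step D S|%SET) =
  bin_op (1 - p * #|S|%:R / n%:R) #|~: S|%SET (iter #|S| push_op g) 0.
Proof.
move=> n0; rewrite (cardE (~: S)%SET).
rewrite -(@round_mean_pull_push g S) ?enum_uniq ?addn0 ?cardE //; last first.
  by move=> i; rewrite mem_enum inE.
apply: eq_bigr => D _; rewrite (@step_calls_update D (enum (~: S)%SET ++ enum S)) //.
by move=> i; rewrite mem_cat !mem_enum inE orNb.
Qed.

Lemma subset_step D : S \subset step D S.
Proof. by apply/fintype.subsetP => v vS; rewrite inE vS. Qed.

End Step.
End Round.

(** * Moments of the number of uninformed nodes after one round *)

Section BinOp.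
Variables (R : realType) (q : R).

Lemma bin_opS a (g : nat -> R) s :
  bin_op q a.+1 g s = q * bin_op q a g s.+1 + (1 - q) * bin_op q a g s.
Proof. by []. Qed.

Lemma eq_bin_op a (g h : nat -> R) s : (forall z, g z = h z) ->
  bin_op q a g s = bin_op q a h s.
Proof. by move=> gh; elim: a s => //= a IH s; rewrite !IH. Qed.

Lemma bin_op_le a (g h : nat -> R) s : 0 <= q <= 1 ->
  (forall z, (s <= z <= s + a)%N -> g z <= h z) ->
  bin_op q a g s <= bin_op q a h s.
Proof.
move=> /andP[q0 q1]; elim: a s => [|a IH] s gh /=.
  by apply: gh; rewrite addn0 leqnn.
apply: lerD; apply: ler_wpM2l; rewrite ?subr_ge0 //; apply: IH => z /andP[sz zs].
  by apply: gh; rewrite (ltnW sz) -addSnnS.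
by apply: gh; rewrite sz addnS leqW.
Qed.

Lemma bin_opD a (g h : nat -> R) s :
  bin_op q a (fun z => g z + h z) s = bin_op q a g s + bin_op q a h s.
Proof. by elim: a s => //= a IH s; rewrite !IH; ring. Qed.

Lemma bin_opZ a c (g : nat -> R) s :
  bin_op q a (fun z => c * g z) s = c * bin_op q a g s.
Proof. by elim: a s => //= a IH s; rewrite !IH; ring. Qed.

Lemma bin_op1 a s : bin_op q a (fun=> 1) s = 1.
Proof. by elim: a s => //= a IH s; rewrite !IH; ring. Qed.

Lemma bin_op_id a s : bin_op q a (fun z => z%:R) s = q * a%:R + s%:R.
Proof. by elim: a s => [|a IH] s /=; rewrite ?IH -?natr1; ring. Qed.

Lemma bin_op_shift a (g : nat -> R) s :
  bin_op q a g s.+1 = bin_op q a (fun z => g z.+1) s.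
Proof. by elim: a s => //= a IH s; rewrite !IH. Qed.

(** Weighting a binomial variable by its value amounts to choosing one of the a + 1 trials and
    forcing it to succeed. *)
Lemma bin_op_size_bias a (g : nat -> R) s :
  bin_op q a.+1 (fun z => (z%:R - s%:R) * g z) s =
  a.+1%:R * q * bin_op q a g s.+1.
Proof.
elim: a s => [|a IH] s.
  by rewrite /= -natr1; ring.
rewrite [LHS]bin_opS.
rewrite (@eq_bin_op a.+1 _ (fun z => (z%:R - s.+1%:R) * g z + g z) s.+1); last first.
  by move=> z; rewrite -natr1; ring.
by rewrite bin_opD !IH bin_opS -[in RHS]natr1; ring.
Qed.

(* Size biasing with g z = 1 / z: the left-hand side times q (a + 1) is the
   probability that a binomial variable with parameters a + 1 and q is nonzero. *)
Lemma bin_op_inv a : 0 < q <= 1 ->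
  bin_op q a (fun z => z.+1%:R^-1) 0 <= (q * a.+1%:R)^-1.
Proof.
move=> /andP[q0 q1].
rewrite -(bin_op_shift a (fun z => z%:R^-1) 0) -[leLHS]mul1r.
have aq : 0 < q * a.+1%:R by rewrite mulr_gt0 // ltr0n.
rewrite -(@ler_pM2l _ (q * a.+1%:R)) // mul1r mulfV ?gt_eqF //.
rewrite (mulrC q) -bin_op_size_bias -[leRHS](bin_op1 a.+1 0).
apply: bin_op_le; first by rewrite ltW.
case=> [|z] _; first by rewrite !mulr0n subrr mul0r.
by rewrite mulr0n subr0 mulfV // pnatr_eq0.
Qed.
End BinOp.

Section Moments.
Variables (R : realType) (p : R) (n : nat).
Hypotheses (p0 : 0 < p) (p1 : p < 1) (n0 : (0 < n)%N).

Let n0' : 0 < n%:R :> R. Proof. by rewrite ltr0n. Qed.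

Lemma push_op_id k z :
  iter k (push_op p n) (fun z => z%:R) z = (1 - p / n%:R) ^+ k * z%:R :> R.
Proof.
elim: k z => [|k IH] z; first by rewrite mul1r.
rewrite iterS {1}/push_op !IH exprS; case: z => [|z] /=; first by rewrite mulr0n; ring.
by rewrite -natr1; ring.
Qed.

(** For z >= 1, [push_op] multiplies 1/(z+1) by exactly 1 + p/n, because 1/z - 1/(z+1) = 1/(z(z+1))
    cancels the z in the hitting probability. Only z = 0 makes it an inequality. *)
Lemma push_op_inv k z : (z <= n)%N ->
  iter k (push_op p n) (fun z => z.+1%:R^-1) z <=
  (1 + p / n%:R) ^+ k / z.+1%:R :> R.
Proof.
elim: k z => [|k IH] z zn; first by rewrite mul1r.
have zn' : z%:R <= n%:R :> R by rewrite ler_nat.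
have rho0 : 0 <= p * z%:R / n%:R by rewrite divr_ge0 ?mulr_ge0 ?ler0n // ltW.
have rho1 : p * z%:R / n%:R <= 1.
  by rewrite ler_pdivrMr // mul1r -[leRHS]mul1r ler_pM ?ler0n // ltW.
have X0 : 0 <= (1 + p / n%:R) ^+ k by rewrite exprn_ge0 // addr_ge0 // divr_ge0 // ltW.
rewrite iterS {1}/push_op.
apply: (le_trans (lerD (ler_wpM2l _ (IH z zn)) (ler_wpM2l rho0 (IH z.-1 _)))).
- by rewrite subr_ge0.
- by rewrite (leq_trans (leq_pred z)).
rewrite exprS; case: z {IH zn zn' rho0 rho1} => [|z] /=.
  rewrite mulr0n mulr0 mul0r subr0 mul0r addr0 mul1r -mulrA ler_peMl ?divr1 //.
  by rewrite ler_wpDr // divr_ge0 // ltW.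
rewrite le_eqVlt; apply/orP; left; apply/eqP.
rewrite -[z.+2%:R]natr1; field.
by rewrite nat1r natr1 !pnatr_eq0 /= andbT -lt0n.
Qed.

(** Each push informs a new node with probability at most p, so the number of nodes gained is
    dominated by a binomial variable with mean p k and variance at most p k. *)
Lemma push_op_sqr k u z : (z <= u)%N -> (u <= n)%N ->
  iter k (push_op p n) (fun z => (u%:R - z%:R) ^+ 2) z <=
  (u%:R - z%:R + p * k%:R) ^+ 2 + p * k%:R.
Proof.
move=> + un; elim: k z => [|k IH] z zu; first by rewrite !mulr0 !addr0.
have zn' : z%:R <= n%:R :> R by rewrite ler_nat (leq_trans zu).
have zu' : 0 <= u%:R - z%:R :> R by rewrite subr_ge0 ler_nat.
have rho0 : 0 <= p * z%:R / n%:R by rewrite divr_ge0 ?mulr_ge0 ?ler0n // ltW.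
have rhop : p * z%:R / n%:R <= p.
  by rewrite ler_pdivrMr // ler_pM2l.
rewrite iterS {1}/push_op.
apply: (le_trans (lerD (ler_wpM2l _ (IH z zu)) (ler_wpM2l rho0 (IH z.-1 _)))).
- by rewrite subr_ge0 (le_trans rhop) // ltW.
- by rewrite (leq_trans (leq_pred z)).
have pk0 : 0 <= p * k%:R by rewrite mulr_ge0 // ltW.
rewrite -[k.+1%:R]natr1.
case: z zu' rho0 rhop {zu zn' IH} => [|z] /= zu' rho0 rhop.
  by rewrite mulr0n mulr0 mul0r subr0 mul1r mul0r addr0; nra.
rewrite -[z.+1%:R]natr1 in zu' rho0 rhop *.
set rho := p * _ / _ in rho0 rhop *.
move: zu'; set d := u%:R - (z%:R + 1) => d0.
have -> : u%:R - z%:R = d + 1 :> R by rewrite /d; ring.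
set b := p * k%:R in pk0 *.
have -> : p * (k%:R + 1) = b + p by rewrite /b; ring.
have H : rho * (2 * (d + b) + 1) <= p * (2 * (d + b) + 1).
  by apply: ler_wpM2r => //; nra.
nra.
Qed.

(** The number of pulls that succeed is binomial with mean (1 - q) a and variance at most that; [c]
    carries the mean and variance bounds of the pushes that follow. *)
Lemma bin_op_sqr q a (c : R) w s : 0 <= q <= 1 -> s%:R + a%:R <= w :> R -> 0 <= c ->
  bin_op q a (fun z => (w - z%:R + c) ^+ 2 + c) s <=
  (w - s%:R - a%:R + (1 - q) * a%:R + c) ^+ 2 + (1 - q) * a%:R + c.
Proof.
move=> /andP[q0 q1] + c0; elim: a s => [|a IH] s /=.
  by rewrite mulr0n !mulr0 !addr0 subr0.
rewrite -natr1 => sw.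
have q1' : 0 <= 1 - q by rewrite subr_ge0.
apply: (le_trans (lerD (ler_wpM2l q0 (IH s.+1 _)) (ler_wpM2l q1' (IH s _)))).
- by rewrite -natr1; lra.
- by lra.
rewrite -[s.+1%:R]natr1.
move: sw; set d := w - s%:R - (a%:R + 1) => sw.
have d0 : 0 <= d by rewrite /d; lra.
have -> : w - (s%:R + 1) - a%:R = d by rewrite /d; ring.
have -> : w - s%:R - a%:R = d + 1 by rewrite /d; ring.
have a0 : 0 <= a%:R :> R by [].
set e := (1 - q) * a%:R.
have -> : (1 - q) * (a%:R + 1) = e + (1 - q) by rewrite /e; ring.
nra.
Qed.

Section Mean.
Variable S : {set 'I_n}.
Hypothesis S0 : (0 < #|S|)%N.
Let k : R := #|S|%:R.
Let u : R := #|~: S|%SET%:R.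
Let x := k / n%:R.

Lemma card_uninformed : u = n%:R - k.
Proof. by rewrite /u /k -[in n%:R](card_ord n) -(cardsC S) natrD addrAC subrr add0r. Qed.

Lemma card_le_n : k <= n%:R.
Proof. by rewrite ler_nat -[leqRHS](card_ord n) max_card. Qed.

Let q0 : 0 < 1 - p * k / n%:R.
Proof.
rewrite subr_gt0 ltr_pdivrMr // mul1r.
by apply: (le_lt_trans (ler_wpM2l (ltW p0) card_le_n)); rewrite gtr_pMl.
Qed.

Let q1 : 1 - p * k / n%:R <= 1.
Proof. by rewrite lerBlDr lerDl divr_ge0 ?mulr_ge0 // ltW. Qed.

Lemma mean_uninformed :
  round_mean p (fun D => #|~: step D S|%SET%:R) =
  u * (1 - p * x) * (1 - p / n%:R) ^+ #|S|.
Proof.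
rewrite (@round_mean_uninformed _ _ _ _ (fun z => z%:R)) //.
rewrite (eq_bin_op _ _ _ (push_op_id _)) bin_opZ bin_op_id /x -/u -/k.
by rewrite mulr0n; ring.
Qed.

Lemma mean_inv_uninformed :
  round_mean p (fun D => #|~: step D S|%SET.+1%:R^-1) <=
  (1 + p / n%:R) ^+ #|S| / ((1 - p * x) * (u + 1)).
Proof.
rewrite (@round_mean_uninformed _ _ _ _ (fun z => z.+1%:R^-1)) //.
set a := #|~: S|%SET.
have an : (a <= n)%N by rewrite -[leqRHS](card_ord n) max_card.
apply: (@le_trans _ _ (bin_op (1 - p * k / n%:R) a
  (fun z => (1 + p / n%:R) ^+ #|S| * z.+1%:R^-1) 0)).
  apply: bin_op_le; first by rewrite ltW.
  move=> z /andP[_ za]; apply: push_op_inv.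
  by rewrite (leq_trans za).
rewrite bin_opZ; apply: ler_wpM2l.
  by rewrite exprn_ge0 // addr_ge0 // divr_ge0 // ltW.
by rewrite /x mulrA natr1; apply: bin_op_inv; rewrite q0.
Qed.

(** Pulls, with mean p k u / n <= p k, and pushes each contribute at most p k to the mean and to the
    variance bound. *)
Lemma mean_sqr_newly_informed :
  round_mean p (fun D => (u - #|~: step D S|%SET%:R) ^+ 2) <=
  (2 * p * k) ^+ 2 + 2 * p * k.
Proof.
rewrite (@round_mean_uninformed _ _ _ _ (fun z => (u - z%:R) ^+ 2)) //.
set a := #|~: S|%SET.
have an : (a <= n)%N by rewrite -[leqRHS](card_ord n) max_card.
have pk0 : 0 <= p * k by rewrite mulr_ge0 // ltW.
apply: (@le_trans _ _ (bin_op (1 - p * k / n%:R) a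
  (fun z => (u - z%:R + p * k) ^+ 2 + p * k) 0)).
  apply: bin_op_le; first by rewrite ltW.
  by move=> z /andP[_ za]; apply: push_op_sqr.
apply: (le_trans (bin_op_sqr _ _ _)) => //; first by rewrite ltW.
  by rewrite mulr0n add0r.
rewrite -/u mulr0n subr0 subrr add0r.
have -> : (1 - (1 - p * k / n%:R)) * u = p * k * (u / n%:R) by ring.
have : p * k * (u / n%:R) <= p * k.
  rewrite ler_piMr // ler_pdivrMr // mul1r ler_nat //.
have : 0 <= p * k * (u / n%:R) by rewrite mulr_ge0 // divr_ge0.
set v := _ * (u / _) => v0 v1.
nra.
Qed.
End Mean.
End Moments.

(** * Elementary inequalities for exp, ln and 1 / (1 + w) *)

Section RealInequalities.
Variable R : realType.
Implicit Types a b c e m w : R.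

Lemma expr_le_expR a j : 0 <= 1 + a -> (1 + a) ^+ j <= expR (a * j%:R).
Proof.
by move=> a0; rewrite expRM_natr; apply: lerXn2r; rewrite ?nnegrE ?expR_ge0 // expR_ge1Dx.
Qed.

Lemma bernoulli_inequality a j : 0 <= a <= 1 -> 1 - a * j%:R <= (1 - a) ^+ j.
Proof.
move=> /andP[a0 a1]; elim: j => [|j IH]; first by rewrite mulr0 subr0.
rewrite exprS -natr1.
have := ler_wpM2l (_ : 0 <= 1 - a) IH; rewrite subr_ge0 => /(_ a1).
apply: le_trans.
have : 0 <= a * a * j%:R by rewrite !mulr_ge0.
by nra.
Qed.

Lemma ln_tangent a m : 0 < a -> 0 < m -> ln a <= ln m + (a / m - 1).
Proof.
move=> a0 m0; rewrite -lerBlDl -ln_div //.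
have := @le_ln1Dx R (a / m - 1); rewrite [1 + _]addrC subrK; apply.
by rewrite ltrBrDl subrr divr_gt0.
Qed.

(** With w = (b - a) / a, this is a quadratic minorant of ln (1 + w), touching it at w = c and valid
    for all w >= 0. It comes from the tangent bound for ln at the ratio (1 + c) / (1 + w). *)
Lemma ln_ge_quadratic a b c : 0 < a -> a <= b -> 0 <= c ->
  ln a + ln (1 + c) + ((b - a) / a - c) / (1 + c) - ((b - a) / a - c) ^+ 2 <= ln b.
Proof.
move=> a0 ab c0; have b0 := lt_le_trans a0 ab; have c1 : 0 < 1 + c by lra.
have H := ln_tangent (mulr_gt0 a0 c1) b0; rewrite lnM // in H.
set w := (b - a) / a; have w0 : 0 <= w by rewrite divr_ge0 ?subr_ge0 // ltW.
have bE : b = a * (1 + w) by rewrite /w; field; rewrite gt_eqF.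
have w1 : 0 < 1 + w by lra.
have E : a * (1 + c) / b = (1 + c) / (1 + w).
  by rewrite bE; field; rewrite !gt_eqF.
have : 0 <= (w - c) ^+ 2 * (1 - ((1 + w) * (1 + c))^-1).
  rewrite mulr_ge0 ?sqr_ge0 // subr_ge0 invf_le1 ?mulr_gt0 //.
  by have := mulr_ge0 w0 c0; lra.
have -> : (w - c) ^+ 2 * (1 - ((1 + w) * (1 + c))^-1) =
    (w - c) ^+ 2 + 1 - (1 + c) / (1 + w) - (w - c) / (1 + c).
  by field; rewrite !gt_eqF.
by rewrite -E; lra.
Qed.

(** The free parameter [e] enters the gain linearly and the loss quadratically, so for small [e] the
    first moment of w outweighs the second. *)
Lemma inv_le_quadratic w e : 0 <= w -> 0 <= e <= 1 ->
  (1 + w)^-1 <= 1 - e * w + e ^+ 2 * w ^+ 2.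
Proof.
move=> w0 /andP[e0 e1].
rewrite -[leLHS]mul1r ler_pdivrMr ?ltr_pwDl //.
rewrite -subr_ge0.
have -> : (1 - e * w + e ^+ 2 * w ^+ 2) * (1 + w) - 1 =
  w * ((e * w - (1 - e) / 2) ^+ 2 + (1 - e) * (1 - (1 - e) / 4)).
  by field.
apply: mulr_ge0 => //; apply: addr_ge0; first exact: sqr_ge0.
by apply: mulr_ge0; lra.
Qed.

End RealInequalities.

(** * The expectation over one round as a positive linear functional *)

Section MeanTheory.
Variables (R : realType) (p : R) (n : nat).
Hypotheses (p0 : 0 < p) (p1 : p < 1) (n0 : (0 < n)%N).
Implicit Types F G : {ffun 'I_n -> 'I_n * bool} -> R.

Lemma round_weight_ge0 (D : {ffun 'I_n -> 'I_n * bool}) : 0 <= round_weight p D.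
Proof.
apply: prodr_ge0 => i _; rewrite mulr_ge0 ?invr_ge0 //.
by case: ifP => _; rewrite ?subr_ge0 ltW.
Qed.

Lemma eq_round_mean F G : F =1 G -> round_mean p F = round_mean p G.
Proof. by move=> FG; apply: eq_bigr => D _; rewrite FG. Qed.

Lemma round_mean_le F G : (forall D, F D <= G D) -> round_mean p F <= round_mean p G.
Proof.
by move=> FG; apply: ler_sum => D _; apply: ler_wpM2l => //; exact: round_weight_ge0.
Qed.

Lemma round_meanD F G :
  round_mean p (fun D => F D + G D) = round_mean p F + round_mean p G.
Proof. by rewrite /round_mean -big_split; apply: eq_bigr => D _; rewrite mulrDr. Qed.

Lemma round_meanZ c F : round_mean p (fun D => c * F D) = c * round_mean p F.
Proof. by rewrite /round_mean mulr_sumr; apply: eq_bigr => D _; rewrite mulrCA. Qed.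

Lemma round_mean_cst c : round_mean p (fun _ : {ffun 'I_n -> 'I_n * bool} => c) = c.
Proof. by rewrite /round_mean -mulr_suml round_weight1 // mul1r. Qed.

(** Jensen's inequality, by averaging the tangent line of ln at [m]. *)
Lemma round_mean_ln_le F m : (forall D, 0 < F D) -> 0 < m -> round_mean p F <= m ->
  round_mean p (fun D => ln (F D)) <= ln m.
Proof.
move=> F0 m0 Fm.
apply: (@le_trans _ _ (round_mean p (fun D => (ln m - 1) + m^-1 * F D))).
  apply: round_mean_le => D; apply: (le_trans (ln_tangent (F0 D) m0)).
  by rewrite le_eqVlt; apply/orP; left; apply/eqP; ring.
rewrite round_meanD round_mean_cst round_meanZ.
by rewrite -addrA gerDl addrC subr_le0 mulrC ler_pdivrMr // mul1r.
Qed.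
End MeanTheory.

(** * Drift of the potentials *)

Section Potentials.
Variables (R : realType) (n : nat).

(** With u + 1 inside the logarithm the potential vanishes once all nodes are informed, and this
    logarithm starts at exactly ln n. *)
Definition lower_potential (A B C : R) (S : {set 'I_n}) : R :=
  A * (ln n%:R - ln #|S|%:R) + B * ln (#|~: S|%SET%:R + 1)
  - C * (#|~: S|%SET%:R / n%:R).

(** The last correction is 1 - 1/(u+1) rather than -1/(u+1), so that every summand is nonnegative,
    as [sum_unfinished_le] demands. *)
Definition upper_potential (A A1 B C C2 : R) (S : {set 'I_n}) : R :=
  A * (ln n%:R - ln #|S|%:R) + A1 * #|S|%:R^-1 + B * ln (#|~: S|%SET%:R + 1)
  + C * (#|~: S|%SET%:R / n%:R) + C2 * (1 - (#|~: S|%SET%:R + 1)^-1).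
End Potentials.

Section Drift.
Variables (R : realType) (p : R) (n : nat).
Hypotheses (p0 : 0 < p) (p1 : p < 1) (n0 : (0 < n)%N).
Variable S : {set 'I_n}.
Hypothesis S0 : (0 < #|S|)%N.
Let k : R := #|S|%:R.
Let u : R := #|~: S|%SET%:R.
Let x := k / n%:R.
Let k' (D : {ffun 'I_n -> 'I_n * bool}) : R := #|step D S|%:R.
Let y (D : {ffun 'I_n -> 'I_n * bool}) : R := #|~: step D S|%SET%:R.

Let n0' : 0 < n%:R :> R. Proof. by rewrite ltr0n. Qed.
Let k1 : 1 <= k. Proof. by rewrite ler1n. Qed.
Let k0 : 0 < k. Proof. by rewrite ltr0n. Qed.
Let kn : k <= n%:R. Proof. exact: card_le_n. Qed.
Let uE : u = n%:R - k. Proof. exact: card_uninformed. Qed.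
Let x0 : 0 < x. Proof. by rewrite divr_gt0. Qed.
Let x1 : x <= 1. Proof. by rewrite ler_pdivrMr ?mul1r. Qed.
Let xn : x * n%:R = k. Proof. by rewrite divfK // gt_eqF. Qed.
Let px1 : 0 < 1 - p * x.
Proof. by rewrite subr_gt0 (le_lt_trans _ p1) // ler_piMr // ltW. Qed.
Let kk' D : k <= k' D. Proof. by rewrite ler_nat subset_leq_card // subset_step. Qed.
Let k'0 D : 0 < k' D. Proof. exact: lt_le_trans (kk' D). Qed.
Let k'n D : k' D <= n%:R. Proof. exact: card_le_n. Qed.
Let yE D : y D = n%:R - k' D. Proof. exact: card_uninformed. Qed.
Let yu D : y D <= u. Proof. by rewrite yE uE lerD2l lerN2. Qed.

Let m := round_mean p y.

Lemma mean_newly_informed : round_mean p (fun D => k' D - k) = u - m.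
Proof.
rewrite (@eq_round_mean _ _ _ _ (fun D => u + -1 * y D)); last first.
  by move=> D; rewrite yE uE; ring.
by rewrite round_meanD round_mean_cst // round_meanZ mulN1r.
Qed.

Lemma mean_uninformed_le_exp : m <= u * (1 - p * x) * expR (- (p * x)).
Proof.
rewrite /m /y mean_uninformed // -/u -/k -/x.
apply: ler_wpM2l; first by rewrite mulr_ge0 // ltW.
have -> : - (p * x) = - (p / n%:R) * #|S|%:R by rewrite /x /k; ring.
apply: expr_le_expR; rewrite subr_ge0 ler_pdivrMr // mul1r.
by rewrite (le_trans (ltW p1)) // ler1n.
Qed.

Lemma mean_uninformed_le : m <= u * (1 - p * x).
Proof.
apply: (le_trans mean_uninformed_le_exp); apply: ler_piMr.
  by rewrite mulr_ge0 // ltW.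
by rewrite expR_le1 oppr_le0 mulr_ge0 // ltW.
Qed.

Lemma mean_uninformed_ge : u - 2 * p * k <= m.
Proof.
have pn : 0 <= p / n%:R <= 1.
  rewrite divr_ge0 ?(ltW p0) //= ler_pdivrMr // mul1r.
  by apply: (le_trans (ltW p1)); rewrite ler1n.
have := bernoulli_inequality #|S| pn; rewrite -/k.
have -> : p / n%:R * k = p * x by rewrite /x; ring.
rewrite /m /y mean_uninformed // -/u -/k -/x => H.
have H1 : 0 <= u * (1 - p * x) by rewrite mulr_ge0 // ltW.
apply: le_trans (ler_wpM2l H1 H).
have H2 : p * x * u <= p * k.
  by rewrite -mulrA ler_pM2l // -[leRHS]xn ler_pM2l // uE lerBlDr lerDl ltW.
have H3 : 0 <= u * (p * x) ^+ 2 by rewrite mulr_ge0 // sqr_ge0.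
by nra.
Qed.

(** Bounding exp (- p x) by 1 / (1 + p x) makes the estimate rational; then u x = k (1 - x) gives
    the stated form. *)
Lemma mean_newly_informed_ge : 2 * p * k * (1 - x) / (1 + p * x) <= u - m.
Proof.
have H0 : 0 < 1 + p * x by rewrite addr_gt0 // mulr_gt0.
have H1 : expR (- (p * x)) <= (1 + p * x)^-1.
  by rewrite expRN lef_pV2 ?posrE ?expR_gt0 // expR_ge1Dx.
have H2 : 0 <= u * (1 - p * x) by rewrite mulr_ge0 // ltW.
have := le_trans mean_uninformed_le_exp (ler_wpM2l H2 H1) => H3.
apply: le_trans (lerB (lexx u) H3).
rewrite le_eqVlt; apply/orP; left; apply/eqP.
rewrite uE /x; field.
rewrite gt_eqF //=.
have -> : n%:R + p * k = n%:R * (1 + p * x) by rewrite /x; field; rewrite gt_eqF.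
by rewrite gt_eqF // mulr_gt0.
Qed.

Lemma mean_sqr_increment :
  round_mean p (fun D => (k' D - k) ^+ 2) <= (2 * p * k) ^+ 2 + 2 * p * k.
Proof.
rewrite (@eq_round_mean _ _ _ _ (fun D => (u - y D) ^+ 2)); last first.
  by move=> D; rewrite yE uE; congr (_ ^+ 2); ring.
exact: mean_sqr_newly_informed.
Qed.

Lemma mean_ln_informed_le : round_mean p (fun D => ln (k' D)) <= ln k + ln (2 * p + 1).
Proof.
have H0 : 0 < 2 * p + 1 by rewrite addr_gt0 // mulr_gt0.
rewrite -lnM //; apply: round_mean_ln_le => //; first by rewrite mulr_gt0.
have := mean_newly_informed; have := mean_uninformed_ge.
rewrite (round_meanD _ _ (fun=> - k)) round_mean_cst //.
by set a := round_mean p _ => H1 H2; have := uE; lra.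
Qed.

Lemma mean_ln_informed_le_max : round_mean p (fun D => ln (k' D)) <= ln n%:R.
Proof.
rewrite -[leRHS](@round_mean_cst _ p n) //.
by apply: round_mean_le => // D; rewrite ler_ln ?k'n // posrE k'0.
Qed.

Lemma mean_ln_informed_ge0 : ln k <= round_mean p (fun D => ln (k' D)).
Proof.
rewrite -[leLHS](@round_mean_cst _ p n) //.
by apply: round_mean_le => // D; rewrite ler_ln ?kk' // posrE ?k'0.
Qed.

(** Jensen's inequality is applied to 1 / (y + 1), whose logarithm is - ln (y + 1). *)
Lemma mean_ln_uninformed_ge :
  ln (u + 1) - p * x + ln (1 - p * x) <= round_mean p (fun D => ln (y D + 1)).
Proof.
have u1 : 0 < u + 1 by rewrite ltr_wpDl.
rewrite -lerN2 -[leLHS]mulN1r -round_meanZ.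
rewrite (@eq_round_mean _ _ _ _ (fun D => ln (#|~: step D S|%SET.+1%:R^-1))); last first.
  by move=> D; rewrite /y natr1 mulN1r lnV // posrE.
have -> : - (ln (u + 1) - p * x + ln (1 - p * x)) =
    ln (expR (p * x) / ((1 - p * x) * (u + 1))).
  rewrite ln_div ?posrE ?expR_gt0 // ?mulr_gt0 //.
  by rewrite expRK lnM //; ring.
apply: round_mean_ln_le => //.
  by rewrite divr_gt0 ?expR_gt0 // mulr_gt0.
apply: (le_trans (mean_inv_uninformed _ _ _ _)) => //.
rewrite ler_pM2r; last by rewrite invr_gt0 mulr_gt0.
have -> : p * x = p / n%:R * #|S|%:R by rewrite /x /k; ring.
by apply: expr_le_expR; rewrite addr_ge0 // divr_ge0 // ltW.
Qed.

Lemma mean_newly_informed_ge_lin : 2 * p * k * (1 - 2 * x) <= u - m.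
Proof.
apply: le_trans mean_newly_informed_ge.
have H0 : 0 < 1 + p * x by rewrite addr_gt0 // mulr_gt0.
rewrite ler_pdivlMr // -[leLHS]mulrA ler_pM2l ?mulr_gt0 //.
have hx := x0; have h1 := p1; have hp := p0.
have : p * x <= x by rewrite ler_piMl // ltW.
have : 0 <= p * x * x by rewrite !mulr_ge0 // ltW.
by nra.
Qed.

(** The quadratic minorant of ln is averaged around the ideal relative growth c = 2 p. The second
    moment leaves a loss c / k <= 2 / k, and the shortfall 2 x c of the mean growth is multiplied by
    a slope with (1 / (1 + c) + 2 c) c <= 10. *)
Lemma mean_ln_informed_ge :
  ln k + ln (2 * p + 1) - 20 * x - 2 / k <= round_mean p (fun D => ln (k' D)).
Proof.
set c := 2 * p; have c0 : 0 < c by rewrite mulr_gt0.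
have c2 : c <= 2 by have h := p1; rewrite /c; lra.
pose c1 := (1 + c)^-1.
have c10 : 0 < c1 by rewrite invr_gt0 addr_gt0.
have c11 : c1 <= 1 by rewrite invf_le1 ?addr_gt0 // lerDl ltW.
pose lb D := (ln k + ln (1 + c) - c * c1 - c ^+ 2) +
  ((c1 + 2 * c) / k * (k' D - k) + - (k ^- 2) * (k' D - k) ^+ 2).
apply: (@le_trans _ _ (round_mean p lb)); last first.
  apply: (round_mean_le p0 p1) => D.
  apply: le_trans (ln_ge_quadratic k0 (kk' D) (ltW c0)).
  rewrite le_eqVlt; apply/orP; left; apply/eqP; rewrite /lb /c1; field.
  by rewrite !gt_eqF // addr_gt0.
rewrite /lb round_meanD round_mean_cst // round_meanD !round_meanZ mean_newly_informed.
have H1 : (c1 + 2 * c) * (c * (1 - 2 * x)) <= (c1 + 2 * c) / k * (u - m).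
  rewrite -mulrA; apply: ler_wpM2l; first by rewrite addr_ge0 ?mulr_ge0 // ltW.
  rewrite [leRHS]mulrC ler_pdivlMr //; apply: le_trans mean_newly_informed_ge_lin.
  by rewrite /c; lra.
have H2 : - k ^- 2 * round_mean p (fun D => (k' D - k) ^+ 2) >= - (c ^+ 2 + c / k).
  rewrite mulNr lerN2 mulrC ler_pdivrMr ?exprn_gt0 //.
  apply: (le_trans mean_sqr_increment).
  rewrite le_eqVlt; apply/orP; left; apply/eqP; rewrite /c; field.
  by rewrite gt_eqF.
have H3 : c / k <= 2 / k by rewrite ler_pM2r // invr_gt0.
have H4 : (c1 + 2 * c) * c <= 10.
  have : c1 * c <= 1 * 2 by apply: ler_pM => //; exact: ltW.
  have : c * c <= 2 * 2 by apply: ler_pM => //; exact: ltW.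
  have -> : (c1 + 2 * c) * c = c1 * c + 2 * (c * c) by ring.
  by lra.
have H5 := ler_wpM2l (ltW x0) H4.
have H6 : 1 + c = c + 1 by rewrite addrC.
rewrite H6 in H1 H2 *.
by move: H1 H2 H3 H5; set q := - k ^- 2 * _; set r := _ / k * (u - m) => H1 H2 H3 H5; lra.
Qed.

Lemma mean_inv_informed_le : x <= 1 / 2 ->
  round_mean p (fun D => (k' D)^-1) <= k^-1 - p ^+ 2 / 96 / k.
Proof.
(* For x <= 1/2 the mean increment is at least p k / 2 and its second moment at most 6 k^2; this [e]
   maximises the net gain e p / 2 - 6 e^2, with value p^2 / 96. *)
move=> x2; pose e : R := p / 24.
have e01 : 0 <= e <= 1.
  by rewrite /e divr_ge0 ?ltW //= ltr_pdivrMr // mul1r (lt_trans p1) // ltr1n.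
pose ub D := k^-1 + (- (e / k ^+ 2) * (k' D - k) + e ^+ 2 / k ^+ 3 * (k' D - k) ^+ 2).
apply: (@le_trans _ _ (round_mean p ub)).
  apply: (round_mean_le p0 p1) => D.
  have w0 : 0 <= (k' D - k) / k by rewrite divr_ge0 ?subr_ge0 ?kk' // ltW.
  have := ler_wpM2l (_ : 0 <= k^-1) (inv_le_quadratic w0 e01).
  rewrite invr_ge0 (ltW k0) => /(_ isT).
  have -> : k^-1 * (1 + (k' D - k) / k)^-1 = (k' D)^-1.
    rewrite -invfM; congr (_^-1); field; rewrite gt_eqF //.
  move/le_trans; apply; rewrite le_eqVlt; apply/orP; left; apply/eqP; rewrite /ub; field.
  by rewrite gt_eqF.
rewrite /ub round_meanD round_mean_cst // round_meanD !round_meanZ mean_newly_informed.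
have e0 : 0 <= e by case/andP: e01.
have H1 : e * (p / 2) / k <= e / k ^+ 2 * (u - m).
  rewrite -mulrA -[leRHS]mulrA; apply: ler_wpM2l => //.
  have -> : p / 2 / k = (k ^+ 2)^-1 * (p / 2 * k) by field; rewrite gt_eqF.
  apply: ler_wpM2l; first by rewrite invr_ge0 exprn_ge0 // ltW.
  apply: le_trans mean_newly_informed_ge.
  have H0 : 0 < 1 + p * x by rewrite addr_gt0 // mulr_gt0.
  rewrite ler_pdivlMr //.
  rewrite (_ : p / 2 * k * (1 + p * x) = (p * k) * ((1 + p * x) / 2)); last by ring.
  rewrite (_ : 2 * p * k * (1 - x) = (p * k) * (2 * (1 - x))); last by ring.
  rewrite ler_pM2l ?mulr_gt0 //.
  have : p * x <= x by rewrite ler_piMl // ltW.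
  by move: x2; lra.
have H2 : e ^+ 2 / k ^+ 3 * round_mean p (fun D => (k' D - k) ^+ 2) <= e ^+ 2 * 6 / k.
  rewrite -mulrA -[leRHS]mulrA; apply: ler_wpM2l; first by rewrite exprn_ge0.
  have -> : 6 / k = (k ^+ 3)^-1 * (6 * k ^+ 2) by field; rewrite gt_eqF.
  apply: ler_wpM2l; first by rewrite invr_ge0 exprn_ge0 // ltW.
  apply: (le_trans mean_sqr_increment).
  have h0 := p0; have h1 := p1; have hk := k1.
  have : p * k <= k by rewrite ler_piMl // ltW.
  have : k <= k ^+ 2 by rewrite expr2 ler_peMl // ltW.
  have : 0 <= p * k by rewrite mulr_ge0 // ltW.
  by nra.
have -> : p ^+ 2 / 96 / k = e * (p / 2) / k - e ^+ 2 * 6 / k.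
  by rewrite /e; field; rewrite gt_eqF.
by move: H1 H2; rewrite mulNr; set q := _ * round_mean _ _; lra.
Qed.

Lemma mean_ln_uninformed_le_start :
  round_mean p (fun D => ln (y D + 1)) <= ln (u + 1).
Proof.
rewrite -[leRHS](@round_mean_cst _ p n) //.
by apply: (round_mean_le p0 p1) => D; rewrite ler_ln ?lerD2r ?yu // posrE ltr_wpDl.
Qed.

(** Near x = 1 an uninformed node stays so with probability about q = (1 - p) exp (- p). A factor
    exp (c (1 - x)) pays for x < 1, and passing from u q + 1 to q (u + 1) costs at most q^-1 / (u +
    1). *)
Lemma mean_ln_uninformed_le :
  round_mean p (fun D => ln (y D + 1)) <=
  ln (u + 1) + (ln (1 - p) - p) + (p + p / (1 - p)) * (1 - x)
  + ((1 - p) * expR (- p))^-1 / (u + 1).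
Proof.
set q := (1 - p) * expR (- p); set c := p + p / (1 - p).
have p1' : 0 < 1 - p by rewrite subr_gt0.
have q0 : 0 < q by rewrite mulr_gt0 // expR_gt0.
have u1 : 0 < u + 1 by rewrite ltr_wpDl.
have x1' : 0 <= 1 - x by rewrite subr_ge0.
have c0 : 0 <= c by rewrite addr_ge0 // ?divr_ge0 // ltW.
have uq : 0 < u * q + 1 by rewrite ltr_wpDl // mulr_ge0 // ltW.
have Hm : m <= u * q * expR (c * (1 - x)).
  apply: (le_trans mean_uninformed_le_exp); rewrite -!mulrA; apply: ler_wpM2l => //.
  have -> : expR (c * (1 - x)) = expR (p * (1 - x)) * expR (p / (1 - p) * (1 - x)).
    by rewrite -expRD; congr expR; rewrite /c mulrDl.
  rewrite /q.
  have -> : expR (- (p * x)) = expR (- p) * expR (p * (1 - x)).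
    by rewrite -expRD; congr expR; ring.
  have H : 1 - p * x <= (1 - p) * expR (p / (1 - p) * (1 - x)).
    have -> : 1 - p * x = (1 - p) * (1 + p / (1 - p) * (1 - x)).
      by field; rewrite gt_eqF.
    by rewrite ler_pM2l // expR_ge1Dx.
  have H' : 0 <= expR (- p) * expR (p * (1 - x)) by rewrite mulr_ge0 // expR_ge0.
  apply: (le_trans (ler_wpM2r H' H)); rewrite le_eqVlt; apply/orP; left; apply/eqP; ring.
apply: (@le_trans _ _ (ln (expR (c * (1 - x)) * (u * q + 1)))).
  apply: round_mean_ln_le => //.
  - by move=> D; rewrite ltr_wpDl.
  - by rewrite mulr_gt0 // expR_gt0.
  - rewrite round_meanD round_mean_cst // -/m.
    have : 1 <= expR (c * (1 - x)) by rewrite -[leLHS]expR0 ler_expR mulr_ge0.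
    by move: Hm; set E := expR _ => Hm HE; lra.
rewrite lnM ?posrE ?expR_gt0 // expRK.
have lq : ln q = ln (1 - p) - p by rewrite lnM ?posrE ?expR_gt0 // expRK.
have qu : 0 < q * (u + 1) by rewrite mulr_gt0.
have := ln_tangent uq qu; rewrite lnM // lq.
have -> : (u * q + 1) / (q * (u + 1)) - 1 = q^-1 / (u + 1) - (u + 1)^-1.
  by field; rewrite !gt_eqF.
have : 0 < (u + 1)^-1 by rewrite invr_gt0.
by set r := (u + 1)^-1; lra.
Qed.

Lemma mean_inv_uninformed_ge_start :
  (u + 1)^-1 <= round_mean p (fun D => (y D + 1)^-1).
Proof.
rewrite -[leLHS](@round_mean_cst _ p n) //.
apply: (round_mean_le p0 p1) => D.
by rewrite lef_pV2 ?lerD2r ?yu // posrE ltr_wpDl.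
Qed.

(** By convexity 1 / (y + 1) lies above its tangent at y = u, and the mean decrease is at least p x
    u >= p u / 2 >= p (u + 1) / 4 since u >= 1. *)
Lemma mean_inv_uninformed_ge : 1 / 2 <= x -> 1 <= u ->
  (u + 1)^-1 + p / 4 / (u + 1) <= round_mean p (fun D => (y D + 1)^-1).
Proof.
move=> x2 u1; have up : 0 < u + 1 by rewrite ltr_wpDl.
apply: (@le_trans _ _ (round_mean p
  (fun D => ((u + 1)^-1 + u / (u + 1) ^+ 2) + - ((u + 1) ^- 2) * y D))).
  rewrite round_meanD round_mean_cst // round_meanZ -/m -addrA lerD2l.
  have := mean_uninformed_le; have hp := p0 => Hm.
  have H1 : p / 4 * (u + 1) <= u - m.
    have : p / 2 * u <= p * x * u by rewrite ler_wpM2r //; nra.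
    have : 0 <= p * (u - 1) by rewrite mulr_ge0 ?(ltW p0) ?subr_ge0.
    by lra.
  have -> : u / (u + 1) ^+ 2 + - (u + 1) ^- 2 * m = (u - m) / (u + 1) ^+ 2.
    by field; rewrite gt_eqF.
  rewrite ler_pdivlMr ?exprn_gt0 //; apply: le_trans H1.
  by rewrite le_eqVlt; apply/orP; left; apply/eqP; field; rewrite gt_eqF.
apply: (round_mean_le p0 p1) => D.
have yp : 0 < y D + 1 by rewrite ltr_wpDl.
rewrite -subr_ge0.
have -> : (y D + 1)^-1 - (((u + 1)^-1 + u / (u + 1) ^+ 2) + - ((u + 1) ^- 2) * y D) =
    (u - y D) ^+ 2 / ((y D + 1) * (u + 1) ^+ 2).
  by field; rewrite !gt_eqF.
by rewrite divr_ge0 ?sqr_ge0 // mulr_ge0 ?exprn_ge0 // ltW.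
Qed.

Let un : u / n%:R = 1 - x.
Proof. by rewrite uE /x mulrBl divff // gt_eqF. Qed.

Lemma mean_uninformed_frac_le : m / n%:R <= 1 - x - p * x * (1 - x).
Proof.
have -> : 1 - x - p * x * (1 - x) = u * (1 - p * x) / n%:R.
  by rewrite -un; ring.
by rewrite ler_pM2r ?invr_gt0 // mean_uninformed_le.
Qed.

Lemma shrink_rate_le_lin : p * x - ln (1 - p * x) <= (1 + (1 - p)^-1) * (p * x).
Proof.
have p1' : 0 < 1 - p by rewrite subr_gt0.
have pxp : 1 - p <= 1 - p * x by rewrite lerD2l lerN2 ler_piMr // ltW.
have := ln_tangent (ltr01 : 0 < 1 :> R) px1; rewrite ln1.
have : (1 - p * x)^-1 <= (1 - p)^-1 by rewrite lef_pV2.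
have E : 1 / (1 - p * x) - 1 = p * x * (1 - p * x)^-1 by field; rewrite gt_eqF.
have px0 : 0 <= p * x by rewrite mulr_ge0 // ltW.
by rewrite E => /(ler_wpM2l px0) H1; lra.
Qed.

Lemma shrink_rate_le : p * x - ln (1 - p * x) <= p - ln (1 - p).
Proof.
have p1' : 0 < 1 - p by rewrite subr_gt0.
have pxp : p * x <= p by rewrite ler_piMr // ltW.
have : ln (1 - p) <= ln (1 - p * x) by rewrite ler_ln ?posrE // lerD2l lerN2.
by lra.
Qed.

(** For x <= 1/2 the [A] term loses at most 1 and the [B] term O(x); for x > 1/2 the [B] term loses
    at most 1 and the [A] term at most its whole value, 2 A (1 - x) or less. The [C] term regains at
    least C p x (1 - x), and the two conditions on [C] match the two phases. *)
Lemma lower_potential_drift A B C : 0 <= A -> A * ln (2 * p + 1) = 1 ->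
  0 <= B -> B * (p - ln (1 - p)) = 1 -> 2 * B * (1 + (1 - p)^-1) <= C ->
  4 * A <= C * p ->
  lower_potential A B C S - 1 <=
  round_mean p (fun D => lower_potential A B C (step D S)).
Proof.
move=> A0 A1 B0 B1 C1 C2.
have -> : round_mean p (fun D => lower_potential A B C (step D S)) =
    A * ln n%:R - A * round_mean p (fun D => ln (k' D)) +
    B * round_mean p (fun D => ln (y D + 1)) - C * (m / n%:R).
  rewrite (@eq_round_mean _ _ _ _ (fun D => A * ln n%:R + - A * ln (k' D) +
    B * ln (y D + 1) + - (C / n%:R) * y D)); last first.
    by move=> D; rewrite /lower_potential /k' /y; ring.
  by rewrite !(round_meanD, round_meanZ) round_mean_cst // -/m; ring.
rewrite /lower_potential -/k -/u un.
have p1' : 0 < 1 - p by rewrite subr_gt0.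
have C0 : 0 <= C.
  by apply: le_trans C1; rewrite !mulr_ge0 // addr_ge0 // invr_ge0 ltW.
have HC := ler_wpM2l C0 mean_uninformed_frac_le.
have HB := ler_wpM2l B0 mean_ln_uninformed_ge.
have Bg := ler_wpM2l B0 shrink_rate_le.
have x1' : 0 <= 1 - x by rewrite subr_ge0.
have px0 : 0 <= p * x by rewrite mulr_ge0 // ltW.
have [x2|x2] := leP x (1 / 2).
- have HA := ler_wpM2l A0 mean_ln_informed_le.
  have Bg' := ler_wpM2l B0 shrink_rate_le_lin.
  have H1 := ler_wpM2r px0 C1.
  have H2 : C * (p * x * (1 / 2)) <= C * (p * x * (1 - x)).
    by apply: ler_wpM2l => //; apply: ler_wpM2l => //; lra.
  by move: HA HB HC; set a := round_mean _ _; set b := round_mean _ _; set c := m / _; nra.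
- have HA := ler_wpM2l A0 mean_ln_informed_le_max.
  have H0 : ln n%:R - ln k <= 2 * (1 - x).
    have := ln_tangent n0' k0.
    have -> : n%:R / k - 1 = (1 - x) / x by rewrite /x; field; rewrite !gt_eqF.
    have : (1 - x) / x <= 2 * (1 - x).
      by rewrite ler_pdivrMr // -mulrA mulrCA ler_peMr //; lra.
    by lra.
  have H1 := ler_wpM2l A0 H0.
  have H2 := ler_wpM2r x1' C2.
  have H3 : C * (p * (1 - x)) * (1 / 2) <= C * (p * (1 - x)) * x.
    apply: ler_wpM2l; last exact: ltW.
    by rewrite !mulr_ge0 // ltW.
  by move: HA HB HC; set a := round_mean _ _; set b := round_mean _ _; set c := m / _; nra.
Qed.

(** For x <= 1/2 the [A] term yields the decrease 1 up to 20 A x + 2 A / k, which [C] and [A1]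
    absorb. For x > 1/2 the [B] term yields it, up to errors in 1 - x and 1 / (u + 1), which [C] and
    [C2] absorb. The remaining terms do not increase in mean. *)
Lemma upper_potential_drift A A1 B C C2 : 0 <= A -> A * ln (2 * p + 1) = 1 ->
  0 <= B -> B * (p - ln (1 - p)) = 1 -> 192 * A <= A1 * p ^+ 2 ->
  40 * A <= C * p -> 2 * B * (p + p / (1 - p)) <= C * p ->
  4 * B * ((1 - p) * expR (- p))^-1 <= C2 * p -> 1 <= u ->
  round_mean p (fun D => upper_potential A A1 B C C2 (step D S)) <=
  upper_potential A A1 B C C2 S - 1.
Proof.
move=> A0 Al B0 Bg A1A CA CB C2B u1.
have -> : round_mean p (fun D => upper_potential A A1 B C C2 (step D S)) =
    A * ln n%:R - A * round_mean p (fun D => ln (k' D)) +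
    A1 * round_mean p (fun D => (k' D)^-1) +
    B * round_mean p (fun D => ln (y D + 1)) + C * (m / n%:R) +
    C2 - C2 * round_mean p (fun D => (y D + 1)^-1).
  rewrite (@eq_round_mean _ _ _ _ (fun D => A * ln n%:R + - A * ln (k' D) +
    A1 * (k' D)^-1 + B * ln (y D + 1) + C / n%:R * y D + C2 +
    - C2 * (y D + 1)^-1)); last first.
    by move=> D; rewrite /upper_potential /k' /y; ring.
  by rewrite !(round_meanD, round_meanZ) !round_mean_cst // -/m; ring.
rewrite /upper_potential -/k -/u un.
have p1' : 0 < 1 - p by rewrite subr_gt0.
have q0 : 0 < (1 - p) * expR (- p) by rewrite mulr_gt0 // expR_gt0.
have C0 : 0 <= C.
  by rewrite -(pmulr_lge0 C p0); apply: le_trans CA; rewrite mulr_ge0.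
have A10 : 0 <= A1.
  by rewrite -(pmulr_lge0 A1 (exprn_gt0 2 p0)); apply: le_trans A1A; rewrite mulr_ge0.
have C20 : 0 <= C2.
  by rewrite -(pmulr_lge0 C2 p0); apply: le_trans C2B; rewrite !mulr_ge0 // invr_ge0 ltW.
have HC := ler_wpM2l C0 mean_uninformed_frac_le.
have x1' : 0 <= 1 - x by rewrite subr_ge0.
have px0 : 0 <= p * x by rewrite mulr_ge0 // ltW.
have ki0 : 0 < k^-1 by rewrite invr_gt0.
have [x2|x2] := leP x (1 / 2).
- have HA := ler_wpM2l A0 mean_ln_informed_ge.
  have HA1 := ler_wpM2l A10 (mean_inv_informed_le x2).
  have HB := ler_wpM2l B0 mean_ln_uninformed_le_start.
  have HC2 := ler_wpM2l C20 mean_inv_uninformed_ge_start.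
  have H2 : C * (p * x * (1 / 2)) <= C * (p * x * (1 - x)).
    by apply: ler_wpM2l => //; apply: ler_wpM2l => //; lra.
  have H1 := ler_wpM2r (ltW x0) CA.
  have H3 := ler_wpM2r (ltW ki0) A1A.
  move: HA HA1 HB HC2 HC.
  set a := round_mean _ _; set b := round_mean _ _; set c := round_mean _ _.
  set d := round_mean _ _; set e := m / _.
  by nra.
- have HA := ler_wpM2l A0 mean_ln_informed_ge0.
  have HA1 : A1 * round_mean p (fun D => (k' D)^-1) <= A1 * k^-1.
    apply: ler_wpM2l => //; rewrite -[leRHS](@round_mean_cst _ p n) //.
    by apply: (round_mean_le p0 p1) => D; rewrite lef_pV2 ?kk' // posrE ?k'0.
  have HB := ler_wpM2l B0 mean_ln_uninformed_le.
  have HC2 := ler_wpM2l C20 (mean_inv_uninformed_ge (ltW x2) u1).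
  have H3 : C * (p * (1 - x)) * (1 / 2) <= C * (p * (1 - x)) * x.
    apply: ler_wpM2l; last exact: ltW.
    by rewrite mulr_ge0 // mulr_ge0 // ltW.
  have H2 := ler_wpM2r x1' CB.
  have ui0 : 0 <= (u + 1)^-1 by rewrite invr_ge0 addr_ge0.
  have H1 := ler_wpM2r ui0 C2B.
  move: HA HA1 HB HC2 HC H1.
  set a := round_mean _ _; set b := round_mean _ _; set c := round_mean _ _.
  set d := round_mean _ _; set e := m / _; set q := (_ * expR _)^-1.
  by nra.
Qed.
End Drift.

(** * Expected hitting time of the chain of informed sets *)

Section Chain.
Variables (R : realType) (p : R) (n : nat).
Hypotheses (p0 : 0 < p) (p1 : p < 1).
Variable i0 : 'I_n.
Implicit Types (S : {set 'I_n}) (f : {set 'I_n} -> R).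

Let n0 : (0 < n)%N. Proof. by case: i0 => i; exact: leq_ltn_trans. Qed.

(** The law of the informed set after t rounds, computed forward from the single node [i0]. *)
Fixpoint chain (t : nat) : {set 'I_n} -> R :=
  if t is t'.+1 then
    fun S => \sum_S' chain t' S' * round_mean p (fun D => (step D S' == S)%:R)
  else fun S => (S == [set i0]%SET)%:R.

Definition chain_mean t f := \sum_S chain t S * f S.

Definition unfinished t := chain_mean t (fun S => (S != [set: 'I_n]%SET)%:R).

Lemma chain_ge0 t S : 0 <= chain t S.
Proof.
elim: t S => [|t IH] S /=; first exact: ler0n.
apply: sumr_ge0 => S' _; apply: mulr_ge0 => //.
by apply: sumr_ge0 => D _; apply: mulr_ge0; rewrite ?ler0n // round_weight_ge0.
Qed.

Lemma chain_mean0 f : chain_mean 0 f = f [set i0]%SET.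
Proof.
rewrite /chain_mean (bigD1 [set i0]%SET) //= eqxx mul1r big1 ?addr0 // => S.
by move=> /negbTE ->; rewrite mul0r.
Qed.

Lemma chain_meanS t f : chain_mean t.+1 f =
  chain_mean t (fun S => round_mean p (fun D => f (step D S))).
Proof.
rewrite /chain_mean /=; under eq_bigr do rewrite mulr_suml.
rewrite exchange_big; apply: eq_bigr => S' _ /=.
under eq_bigr do rewrite -mulrA.
rewrite -mulr_sumr; congr (_ * _).
under eq_bigr do rewrite /round_mean mulr_suml.
rewrite exchange_big; apply: eq_bigr => D _ /=.
under eq_bigr do rewrite -mulrA.
rewrite -mulr_sumr; congr (_ * _).
rewrite (bigD1 (step D S')) //= eqxx mul1r big1 ?addr0 // => S.
by rewrite eq_sym => /negbTE ->; rewrite mul0r.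
Qed.

(** This confines the chain to nonempty sets, the only ones for which the drift bounds are
    available. *)
Lemma chain_eq0 t S : i0 \notin S -> chain t S = 0.
Proof.
elim: t S => [|t IH] S iS /=.
  by case: eqP => // E; move: iS; rewrite E inE eqxx.
apply: big1 => S' _; have [iS'|iS'] := boolP (i0 \in S'); last by rewrite IH ?mul0r.
rewrite [X in _ * X](_ : _ = 0) ?mulr0 //; apply: big1 => D _.
case: eqP => [E|]; last by rewrite mulr0.
by move: iS; rewrite -E (fintype.subsetP (subset_step _ _)).
Qed.

Lemma unfinished_ge0 t : 0 <= unfinished t.
Proof. by apply: sumr_ge0 => S _; rewrite mulr_ge0 ?chain_ge0 ?ler0n. Qed.

Lemma step_full D : step D [set: 'I_n]%SET = [set: 'I_n]%SET.
Proof. by apply/eqP; rewrite -finset.subTset subset_step. Qed.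

Lemma chain_mean_le t f g : (forall S, (0 < #|S|)%N -> f S <= g S) ->
  chain_mean t f <= chain_mean t g.
Proof.
move=> fg; apply: ler_sum => S _.
have [iS|iS] := boolP (i0 \in S); last by rewrite chain_eq0 // !mul0r.
apply: ler_wpM2l; first exact: chain_ge0.
by apply: fg; apply/card_gt0P; exists i0.
Qed.

Lemma chain_meanB_unfinished t f :
  chain_mean t (fun S => f S - (S != [set: 'I_n]%SET)%:R) =
  chain_mean t f - unfinished t.
Proof.
by rewrite /unfinished /chain_mean -sumrB; apply: eq_bigr => S _; rewrite mulrBr.
Qed.

Lemma round_mean_full f :
  round_mean p (fun D => f (step D [set: 'I_n]%SET)) = f [set: 'I_n]%SET.
Proof.
rewrite (@eq_round_mean _ _ _ _ (fun=> f [set: 'I_n]%SET)); first exact: round_mean_cst.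
by move=> D; rewrite step_full.
Qed.

(** The mean of f drops by at least [unfinished] t in round t, the full set being absorbing;
    telescoping and f >= 0 give the bound. *)
Lemma sum_unfinished_le f N : (forall S, 0 <= f S) ->
  (forall S, (0 < #|S|)%N -> S != [set: 'I_n]%SET ->
     round_mean p (fun D => f (step D S)) <= f S - 1) ->
  \sum_(0 <= t < N) unfinished t <= f [set i0]%SET.
Proof.
move=> f0 drift.
suff : \sum_(0 <= t < N) unfinished t <= f [set i0]%SET - chain_mean N f.
  move=> /le_trans; apply; rewrite gerBl; apply: sumr_ge0 => S _.
  by rewrite mulr_ge0 // chain_ge0.
elim: N => [|N IH]; first by rewrite big_nil chain_mean0 subrr.
have : chain_mean N.+1 f <= chain_mean N f - unfinished N.
  rewrite chain_meanS -chain_meanB_unfinished; apply: chain_mean_le => S S0.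
  have [->|ST] := eqVneq S [set: 'I_n]%SET; last exact: drift.
  by rewrite subr0 round_mean_full.
by rewrite big_nat_recr //=; lra.
Qed.

Lemma sum_unfinished_ge f N :
  (forall S, (0 < #|S|)%N -> S != [set: 'I_n]%SET ->
     f S - 1 <= round_mean p (fun D => f (step D S))) ->
  f [set i0]%SET - chain_mean N f <= \sum_(0 <= t < N) unfinished t.
Proof.
move=> drift; elim: N => [|N IH]; first by rewrite big_nil chain_mean0 subrr.
have : chain_mean N f - unfinished N <= chain_mean N.+1 f.
  rewrite chain_meanS -chain_meanB_unfinished; apply: chain_mean_le => S S0.
  have [->|ST] := eqVneq S [set: 'I_n]%SET; last exact: drift.
  by rewrite subr0 round_mean_full.
by rewrite big_nat_recr //=; lra.
Qed.

(** This controls the leftover mean in [sum_unfinished_ge]: the full set contributes nothing, and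
    elsewhere f is at most the sum of all |f S|. *)
Lemma chain_mean_le_unfinished f N : f [set: 'I_n]%SET = 0 ->
  chain_mean N f <= (\sum_S `|f S|) * unfinished N.
Proof.
move=> fT; rewrite /unfinished /chain_mean mulr_sumr; apply: ler_sum => S _.
rewrite mulrCA; apply: ler_wpM2l; first exact: chain_ge0.
have [->|ST] := eqVneq S [set: 'I_n]%SET; first by rewrite fT mulr0.
rewrite mulr1 (bigD1 S) //=; apply: (le_trans (ler_norm _)).
by rewrite lerDl sumr_ge0.
Qed.

(* If the limit of the partial sums were smaller than f [set i0], then
   [unfinished] would be bounded away from 0 and its partial sums unbounded. *)
Lemma sum_unfinished_lim_ge f (s : R) :
  (forall S, (0 < #|S|)%N -> S != [set: 'I_n]%SET ->
     f S - 1 <= round_mean p (fun D => f (step D S))) ->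
  f [set: 'I_n]%SET = 0 ->
  (forall N, \sum_(0 <= t < N) unfinished t <= s) -> f [set i0]%SET <= s.
Proof.
move=> drift fT sle; rewrite leNgt; apply/negP => sf.
set e := f [set i0]%SET - s; have e0 : 0 < e by rewrite subr_gt0.
set M := 1 + \sum_S `|f S|.
have M0 : 0 < M by rewrite ltr_pwDl // sumr_ge0.
have low N : e / M <= unfinished N.
  have := sum_unfinished_ge N drift; have := sle N.
  have := chain_mean_le_unfinished N fT; have := unfinished_ge0 N.
  rewrite ler_pdivrMr // /e /M; lra.
have lowN N : N%:R * (e / M) <= s.
  apply: le_trans (sle N).
  have -> : N%:R * (e / M) = \sum_(0 <= t < N) (e / M).
    by rewrite sumr_const_nat subn0 mulr_natl.
  by apply: ler_sum => t _; exact: low.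
have := lowN (Num.bound `|s / (e / M)|).
apply/negP; rewrite -ltNge -ltr_pdivrMr ?divr_gt0 //.
apply: (le_lt_trans (ler_norm _)); exact: archi_boundP (normr_ge0 _).
Qed.
End Chain.

(** * From the random calls to the chain *)

Section FinitePartition.
Local Open Scope classical_set_scope.
Context d (T : measurableType d) (R : realType) (P : probability T R).
Variables (V : finType) (f : T -> V).
Hypothesis mf : forall v, measurable [set w | f w = v].

Lemma measurable_fin_preimage (A : pred V) : measurable [set w | A (f w)].
Proof.
rewrite (_ : [set w | A (f w)] = \bigcup_(v in [set v | A v]) [set w | f w = v]).
  by apply: fin_bigcup_measurable => // v _; exact: mf.
by apply/seteqP; split=> [w Aw|w [v Av] /= ->] //; exists (f w).
Qed.

Lemma measure_fin_partition (E : set T) : measurable E ->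
  P E = (\sum_v P (E `&` [set w | f w = v]))%E.
Proof.
move=> mE.
have H (l : seq V) : uniq l ->
    P (E `&` [set w | f w \in l]) = (\sum_(v <- l) P (E `&` [set w | f w = v]))%E.
  elim: l => [|v l IH] /=.
    move=> _; rewrite big_nil [X in P X](_ : _ = set0) ?measure0 //.
    by apply/seteqP; split => w // [].
  move=> /andP[vl ul]; rewrite big_cons -IH // -measureU.
  - congr (P _); apply/seteqP; split => [w [Ew] /=|w [[Ew /= ->]|[Ew /= fw]]].
    + by rewrite inE => /orP[/eqP|] fw; [left|right].
    + by split=> //=; rewrite inE eqxx.
    + by split=> //=; rewrite inE fw orbT.
  - by apply: measurableI => //; exact: mf.
  - by apply: measurableI => //; exact: (measurable_fin_preimage (fun v => v \in l)).
  - by apply/seteqP; split => w // [[_ /= fw] [_ /=]]; rewrite fw (negbTE vl).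
rewrite -[in RHS]big_enum -H ?enum_uniq //; congr (P _).
by apply/seteqP; split => [w Ew|w []//]; split => //=; rewrite mem_enum.
Qed.
End FinitePartition.

Section Bridge.
Local Open Scope classical_set_scope.
Context (R : realType) (p : R) (n : nat) (d : measure_display)
  (Omega : measurableType d) (P : probability Omega R)
  (call : nat -> 'I_n -> Omega -> 'I_n) (succ : nat -> 'I_n -> Omega -> bool)
  (x0 : 'I_n).
Hypothesis calls : push_pull_calls P p call succ.

Let outcome := {ffun 'I_n -> 'I_n * bool}.
Let key : choiceType := (nat * 'I_n + nat * 'I_n)%type.

Definition round_outcome t w : outcome := [ffun i => (call t i w, succ t i w)].

Definition state t w : {set 'I_n} :=
  informed (fun t i => call t i w) (fun t i => succ t i w) x0 t.

Lemma stateS t w : state t.+1 w = step (round_outcome t w) (state t w).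
Proof.
rewrite /state /= /step; congr push_pull_step; apply/funext => i.
  by rewrite ffunE.
by rewrite ffunE.
Qed.

Lemma measurable_succ_eq t i b : measurable [set w | succ t i w = b].
Proof.
have m1 := measurable_succ calls t i.
case: b; first exact: m1.
rewrite (_ : [set w | _] = ~` (succ t i @^-1` [set true])); first exact: measurableC.
by apply/seteqP; split => w /=; case: (succ t i w).
Qed.

Lemma prob_succ t i b : P [set w | succ t i w = b] = (if b then p else 1 - p)%:E.
Proof.
have m1 := measurable_succ calls t i.
case: b; first exact: (succ_bernoulli calls t i).
rewrite (_ : [set w | _] = ~` (succ t i @^-1` [set true])).
  by rewrite probability_setC // (succ_bernoulli calls).
by apply/seteqP; split => w /=; case: (succ t i w).
Qed.

Lemma measurable_round_outcome t D : measurable [set w | round_outcome t w = D].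
Proof.
rewrite (_ : [set w | _] = \bigcap_(i in [set: 'I_n])
   ((call t i @^-1` [set (D i).1]) `&` [set w | succ t i w = (D i).2])).
  apply: fin_bigcap_measurable => // i _; apply: measurableI.
    exact: (measurable_call calls).
  exact: measurable_succ_eq.
apply/seteqP; split => [w <- i _|w H]; first by rewrite /= !ffunE.
apply/ffunP => i; rewrite ffunE; have [/= -> ->] := H i I.
by case: (D i).
Qed.

Lemma measurable_state t S : measurable [set w | state t w = S].
Proof.
elim: t S => [|t IH] S.
  rewrite /state /=; have [->|/eqP E] := eqVneq [set x0]%SET S.
    by rewrite (_ : [set w | _] = setT) //; apply/seteqP; split.
  by rewrite (_ : [set w | _] = set0) //; apply/seteqP; split.
pose f w := (round_outcome t w, state t w).
have mf v : measurable [set w | f w = v].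
  rewrite (_ : [set w | _] =
    [set w | round_outcome t w = v.1] `&` [set w | state t w = v.2]).
    by apply: measurableI => //; exact: measurable_round_outcome.
  by rewrite /f; case: v => a b; apply/seteqP; split => w /= [-> ->].
rewrite (_ : [set w | _] = [set w | step (f w).1 (f w).2 == S]).
  exact: (measurable_fin_preimage mf (fun v => step v.1 v.2 == S)).
by apply/seteqP; split => w /=; rewrite stateS => /eqP.
Qed.

Definition outcomes_on (G : nat -> outcome) t s : set Omega :=
  [set w | forall r, (t <= r < s)%N -> round_outcome r w = G r].

Lemma measurable_outcomes_on G t s : measurable (outcomes_on G t s).
Proof.
rewrite (_ : outcomes_on G t s =
  \bigcap_(r in `I_s) [set w | (t <= r)%N -> round_outcome r w = G r]).
  apply: fin_bigcap_measurable => [|r _]; first exact: finite_II.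
  have [tr|tr] := boolP (t <= r)%N.
    rewrite (_ : [set w | _] = [set w | round_outcome r w = G r]).
      exact: measurable_round_outcome.
    by apply/seteqP; split => w /= H; [exact: H|move=> _].
  by rewrite (_ : [set w | _] = setT) //; apply/seteqP; split.
apply/seteqP; split => w /= H r; first by move=> rs tr; apply: H; rewrite tr.
by move=> /andP[tr rs]; exact: H.
Qed.

(** Independence enters here: it is applied at once to the list of all calls and all successes of
    the rounds before [s]. *)
Lemma prob_outcomes_on0 G s :
  P (outcomes_on G 0 s) = (\prod_(0 <= r < s) round_weight p (G r))%:E.
Proof.
pose l : seq key := [seq inl (r, i) | r <- iota 0 s, i <- enum 'I_n] ++
                    [seq inr (r, i) | r <- iota 0 s, i <- enum 'I_n].
pose A (k : key) : set (draw_value k) :=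
  match k with
  | inl ti => [set (G ti.1 ti.2).1]
  | inr ti => [set (G ti.1 ti.2).2]
  end.
have ul : uniq l.
  rewrite cat_uniq !allpairs_uniq ?iota_uniq ?enum_uniq ?andbT //=.
  - apply/hasPn => k /allpairsP[[r i] [_ _ ->]].
    by apply/negP => /allpairsP[[r' i'] [_ _]].
  - by move=> [r i] [r' i'] _ _ [-> ->].
  - by move=> [r i] [r' i'] _ _ [-> ->].
have := draws_independent calls A ul.
have -> : \bigcap_(k in [set` l]) (draw call succ k @^-1` A k) = outcomes_on G 0 s.
  apply/seteqP; split => w H.
    move=> r /= rs; apply/ffunP => i; rewrite ffunE.
    have Hl : (inl (r, i) : key) \in l.
      rewrite mem_cat; apply/orP; left; apply/allpairsP; exists (r, i).
      by rewrite mem_iota mem_enum.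
    have Hr : (inr (r, i) : key) \in l.
      rewrite mem_cat; apply/orP; right; apply/allpairsP; exists (r, i).
      by rewrite mem_iota mem_enum.
    have /= -> := H _ Hl; have /= -> := H _ Hr.
    by case: (G r i).
  move=> k /=; rewrite mem_cat => /orP[] /allpairsP[[r i] [/=]];
    rewrite mem_iota add0n => /= rs _ -> /=; by rewrite -(H r rs) ffunE.
move=> ->; rewrite big_cat /= !big_allpairs_dep.
under eq_bigr => r _.
  under eq_bigr => i _ do rewrite /= (call_uniform calls).
  over.
under [X in (_ * X)%E]eq_bigr => r _.
  under eq_bigr => i _ do rewrite /= (prob_succ r i).
  over.
have EFin_prod I (q : seq I) (F : I -> R) :
    (\prod_(i <- q) (F i)%:E)%E = (\prod_(i <- q) F i)%:E.
  by rewrite (big_morph EFin (fun x y => EFinM x y) erefl).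
under eq_bigr do rewrite EFin_prod.
under [X in (_ * X)%E]eq_bigr do rewrite EFin_prod.
rewrite !EFin_prod -EFinM; congr EFin.
rewrite -big_split /= /index_iota subn0; apply: eq_bigr => r _.
rewrite -big_split /= big_enum /=; by apply: eq_bigr.
Qed.

(* The outcomes of later rounds belong to the event so that induction on t
   carries their independence of the current state. *)
Lemma prob_state_outcomes G t s S : (t <= s)%N ->
  P ([set w | state t w = S] `&` outcomes_on G t s) =
  (chain p x0 t S * \prod_(t <= r < s) round_weight p (G r))%:E.
Proof.
elim: t G S => [|t IH] G S ts.
  rewrite /chain /state /= eq_sym; have [->|/eqP E] := eqVneq [set x0]%SET S.
    rewrite mul1r -prob_outcomes_on0; congr (P _).
    by apply/seteqP; split => w // [].
  rewrite mul0r (_ : _ `&` _ = set0) ?measure0 //.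
  by apply/seteqP; split => w // [/=].
pose f w := (state t w, round_outcome t w).
have mf v : measurable [set w | f w = v].
  rewrite (_ : [set w | _] =
    [set w | state t w = v.1] `&` [set w | round_outcome t w = v.2]).
    by apply: measurableI; [exact: measurable_state | exact: measurable_round_outcome].
  by rewrite /f; case: v => a b; apply/seteqP; split => w /= [-> ->].
rewrite (measure_fin_partition P mf); last first.
  by apply: measurableI; [exact: measurable_state | exact: measurable_outcomes_on].
transitivity (\sum_S' \sum_D P (([set w | state t.+1 w = S] `&` outcomes_on G t.+1 s)
    `&` [set w | f w = (S', D)]))%E.
  by rewrite pair_bigA; apply: eq_bigr => -[].
rewrite /= mulr_suml -sumEFin.
apply: eq_bigr => S' _; rewrite -mulrA /round_mean mulr_suml mulr_sumr -sumEFin.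
apply: eq_bigr => D _.
have [E|E] := eqVneq (step D S') S; last first.
  rewrite mulr0 mul0r mulr0 (_ : _ `&` _ = set0) ?measure0 //.
  apply/seteqP; split => w // [[/= SS _]] [E1 E2].
  by move/eqP: E; apply; rewrite -SS stateS E1 E2.
rewrite mulr1.
(* Prescribing also the outcome D of round t turns the event into one about the state at time t and
   the rounds from t on, to which the induction hypothesis applies. *)
pose G' r := if r == t then D else G r.
have -> : round_weight p D * \prod_(t.+1 <= r < s) round_weight p (G r) =
    \prod_(t <= r < s) round_weight p (G' r).
  rewrite [RHS]big_ltn // /G' eqxx; congr (_ * _).
  by apply: eq_big_nat => r /andP[tr _]; rewrite gtn_eqF.
rewrite -IH ?(ltnW ts) //; congr (P _).
apply/seteqP; split => w /=.
  move=> [[SS H] [E1 E2]]; split => // r /andP[tr rs]; rewrite /G'.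
  case: eqP => [->//|/eqP rt]; apply: H; rewrite rs andbT.
  by rewrite ltn_neqAle eq_sym rt.
move=> [E1 H].
have E2 : round_outcome t w = D by rewrite H ?leqnn // /G' eqxx.
split; last by rewrite /f E1 E2.
split; first by rewrite stateS E1 E2.
move=> r /andP[tr rs]; rewrite H ?(ltnW tr) // /G' gtn_eqF //.
Qed.

Lemma prob_state t S : P [set w | state t w = S] = (chain p x0 t S)%:E.
Proof.
(* The prescribed outcomes are arbitrary, since the range of rounds from t to t is empty. *)
have := prob_state_outcomes (fun=> [ffun=> (x0, true)]) S (leqnn t).
rewrite big_geq // mulr1 => <-; congr (P _); apply/seteqP; split => w.
  by move=> /= H; split => // r /andP[tr rt]; move: (leq_trans rt tr); rewrite ltnn.
by case.
Qed.

Definition not_finished t : set Omega := [set w | state t w != [set: 'I_n]%SET].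

Lemma measurable_not_finished t : measurable (not_finished t).
Proof.
exact: (measurable_fin_preimage (measurable_state t)
  (fun S => S != [set: 'I_n]%SET)).
Qed.

Lemma prob_not_finished t : P (not_finished t) = (unfinished p x0 t)%:E.
Proof.
rewrite (measure_fin_partition P (measurable_state t)); last exact: measurable_not_finished.
rewrite /unfinished /chain_mean -sumEFin; apply: eq_bigr => S _.
have [->|ST] := eqVneq S [set: 'I_n]%SET; rewrite ?mulr0 ?mulr1.
  rewrite (_ : _ `&` _ = set0) ?measure0 //.
  by apply/seteqP; split => w // [/= /eqP].
rewrite -prob_state; congr (P _); apply/seteqP; split => w; first by case.
by move=> /= E; split=> //; rewrite /not_finished /= E.
Qed.

Lemma state_full_mono t s w : (t <= s)%N -> state t w = [set: 'I_n]%SET ->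
  state s w = [set: 'I_n]%SET.
Proof.
move=> /subnK <-; elim: (s - t)%N => [//|r IH] H.
by rewrite addSn stateS IH // step_full.
Qed.

(** Full states stay full, so the indicators equal 1 exactly before the first full state. If there
    is none, the series diverges and the infimum of the empty set is +oo as well. *)
Lemma spreading_time_series w :
  spreading_time R call succ x0 w =
  (\sum_(0 <= t <oo) (\1_(not_finished t) w)%:E)%E.
Proof.
have ind t : \1_(not_finished t) w = (state t w != [set: 'I_n]%SET)%:R :> R.
  by rewrite indicE; congr (nat_of_bool _)%:R; apply/idP/idP; rewrite inE.
under eq_eseriesr do rewrite ind.
have [[t0 Ht0]|noT] := pselect (exists t, state t w == [set: 'I_n]%SET).
  pose tau := ex_minn (ex_intro (fun t => state t w == [set: 'I_n]%SET) t0 Ht0).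
  have [tauT tau_min] : state tau w = [set: 'I_n]%SET /\
      forall t, state t w = [set: 'I_n]%SET -> (tau <= t)%N.
    by rewrite /tau; case: ex_minnP => m /eqP mT mm; split => // t /eqP; exact: mm.
  rewrite (@nneseries_split _ _ 0 tau); last by move=> k _; rewrite lee_fin ler0n.
  rewrite add0n [X in (_ + X)%E]eseries0; last first.
    by move=> i ti _; rewrite (state_full_mono ti tauT) eqxx.
  rewrite adde0 sumEFin (eq_big_nat _ _ (F2 := fun=> 1)); last first.
    move=> i /andP[_ it]; case: eqP => // /tau_min.
    by rewrite leqNgt it.
  rewrite sumr_const_nat subn0; apply/eqP; rewrite eq_le; apply/andP; split.
    by apply: ereal_inf_lbound; exists tau.
  by apply: le_ereal_inf_tmp => _ [t tT <-]; rewrite lee_fin ler_nat tau_min.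
have noT' t : (state t w != [set: 'I_n]%SET).
  by apply/negP => H; apply: noT; exists t.
rewrite /spreading_time (_ : [set t : nat | _] = set0); last first.
  by apply/seteqP; split => // t /= H; apply: noT; exists t; apply/eqP.
rewrite image_set0 ereal_inf0; apply/esym/cvg_lim => //.
rewrite (_ : (fun N => _) = (fun N => N%:R%:E)); last first.
  apply/funext => N; rewrite sumEFin; congr EFin.
  under eq_bigr do rewrite noT'.
  by rewrite sumr_const_nat subn0.
by apply/cvgenyP; exact: cvg_id.
Qed.

(** The tail-sum formula for the expectation, by exchanging the integral with a series of
    nonnegative functions. *)
Lemma integral_spreading_time :
  (\int[P]_w spreading_time R call succ x0 w =
   \sum_(0 <= t <oo) (unfinished p x0 t)%:E)%E.
Proof.
under eq_integral do rewrite spreading_time_series.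
rewrite integral_nneseries //.
- apply: eq_eseriesr => t _; rewrite integral_indic //; last exact: measurable_not_finished.
  rewrite setIT; exact: prob_not_finished.
- move=> t; apply/measurable_EFinP; apply: measurable_indic; exact: measurable_not_finished.
Qed.
End Bridge.

(** * Choice of the constants and conclusion *)

Lemma upper_potential_ge0 (R : realType) (n : nat) (A A1 B C C2 : R) (S : {set 'I_n}) :
  (0 < n)%N -> 0 <= A -> 0 <= A1 -> 0 <= B -> 0 <= C -> 0 <= C2 ->
  0 <= upper_potential A A1 B C C2 S.
Proof.
move=> n0 A0 A10 B0 C0 C20; rewrite /upper_potential !addr_ge0 // mulr_ge0 //.
(* The empty set is covered too: the value of ln at 0 is at most 0. *)
- rewrite subr_ge0; have [->|S0] := posnP #|S|.
    by apply: (@le_trans _ _ 0); [exact: ln_le0|apply: ln_ge0; rewrite ler1n].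
  rewrite ler_ln ?posrE ?ltr0n // ler_nat -[leqRHS](card_ord n) max_card //.
- by apply: ln_ge0; rewrite lerDr.
- by rewrite subr_ge0 invf_le1 ?lerDr // ltr_wpDl.
Qed.

Theorem theorem56 (R : realType) (p : R) (hp0 : 0 < p) (hp1 : p < 1) :
  exists (C : R) (N : nat), forall n : nat, (N <= n)%N ->
  forall (d : measure_display) (Omega : measurableType d)
    (P : probability Omega R)
    (call : nat -> 'I_n -> Omega -> 'I_n)
    (succ : nat -> 'I_n -> Omega -> bool) (x0 : 'I_n),
  push_pull_calls P p call succ ->
  (`| \int[P]_w spreading_time R call succ x0 w
      - (ln n%:R / ln (2 * p + 1)
         + 1 / (p + ln (1 / (1 - p))) * ln n%:R)%:E | <= C%:E)%E.
Proof.
have p1' : 0 < 1 - p by rewrite subr_gt0.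
have lnp : ln (1 - p) <= 0 by apply: ln_le0; rewrite gerBl ltW.
pose L : R := ln (2 * p + 1).
have L0 : 0 < L by apply: ln_gt0; rewrite ltrDr mulr_gt0.
pose g := p - ln (1 - p); have g0 : 0 < g by rewrite ltr_wpDr // oppr_ge0.
have gE : p + ln (1 / (1 - p)) = g by rewrite mul1r lnV ?posrE.
pose A := L^-1; pose B := g^-1.
have A0 : 0 < A by rewrite invr_gt0.
have B0 : 0 < B by rewrite invr_gt0.
have AL : A * ln (2 * p + 1) = 1 by rewrite mulVf // gt_eqF.
have Bg : B * (p - ln (1 - p)) = 1 by rewrite mulVf // gt_eqF.
(* These are the bounds that the drift lemmas impose on the correction coefficients; below, sums of
   bounds are taken where one coefficient must meet two of them. *)
pose b1 := 2 * B * (1 + (1 - p)^-1); pose b2 := 2 * B * (p + p / (1 - p)).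
pose b3 := 4 * B * ((1 - p) * expR (- p))^-1.
have i0 : 0 <= (1 - p)^-1 by rewrite invr_ge0 ltW.
have b10 : 0 <= b1 by rewrite !mulr_ge0 ?addr_ge0 // ltW.
have b20 : 0 <= b2 by rewrite mulr_ge0 ?addr_ge0 ?mulr_ge0 // ltW.
have b30 : 0 <= b3 by rewrite mulr_ge0 ?invr_ge0 ?mulr_ge0 ?expR_ge0 // ltW.
pose Cl := b1 + 4 * A / p; pose A1 := 192 * A / p ^+ 2.
pose Cu := (40 * A + b2) / p; pose C2 := b3 / p.
have [A0' B0' p0'] := And3 (ltW A0) (ltW B0) (ltW hp0).
have A40 : 0 <= 4 * A / p by rewrite divr_ge0 ?mulr_ge0.
have Cl0 : 0 <= Cl by rewrite addr_ge0.
have A10 : 0 <= A1 by rewrite divr_ge0 ?mulr_ge0 ?exprn_ge0.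
have Cu0 : 0 <= Cu by apply: divr_ge0 => //; apply: addr_ge0 => //; exact: mulr_ge0.
have C20 : 0 <= C2 by rewrite divr_ge0.
(* The constant adds the lower error [Cl] to the upper error [A1] + [Cu] + [C2]. Threshold 0
   suffices, as the node [x0] forces n >= 1. *)
exists (Cl + A1 + Cu + C2), 0%N => n _ d Omega P call succ x0 calls.
have n0 : (0 < n)%N by case: x0 => i; exact: leq_ltn_trans.
have n0' : 0 < n%:R :> R by rewrite ltr0n.
rewrite (integral_spreading_time x0 calls).
have pn : p != 0 by rewrite gt_eqF.
have up N : \sum_(0 <= t < N) unfinished p x0 t <= upper_potential A A1 B Cu C2 [set x0]%SET.
  apply: sum_unfinished_le => // S => [|S0 ST].
    exact: upper_potential_ge0.
  apply: upper_potential_drift => //=> //.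
  - by rewrite /A1 divfK // expf_neq0.
  - by rewrite /Cu divfK // lerDl.
  - by rewrite /Cu divfK // lerDr mulr_ge0 // ltW.
  - by rewrite /C2 divfK.
  - rewrite ler1n lt0n cards_eq0; apply: contra ST => /eqP E.
    by rewrite -(finset.setCK S) E finset.setC0.
(* At the start k = 1 and u + 1 = n, so the main terms of both potentials equal (A + B) ln n exactly
   and only the corrections need bounding. *)
have card1 : #|[set x0]%SET|%:R = 1 :> R by rewrite cards1.
have cardC1 : #|~: [set x0]|%SET%:R = n%:R - 1 :> R by rewrite card_uninformed card1.
have upE : upper_potential A A1 B Cu C2 [set x0]%SET <=
    A * ln n%:R + B * ln n%:R + (A1 + Cu + C2).
  rewrite /upper_potential card1 cardC1 subrK ln1 subr0 invr1 mulr1.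
  have : Cu * ((n%:R - 1) / n%:R) <= Cu.
    by rewrite ler_piMr // ler_pdivrMr // mul1r gerBl.
  have : C2 * (1 - n%:R^-1) <= C2 by rewrite ler_piMr // gerBl invr_ge0 ltW.
  by lra.
have cv := @is_cvg_nneseries _ (fun t => (unfinished p x0 t)%:E) xpredT 0%N
  (fun t _ _ => unfinished_ge0 hp0 hp1 x0 t).
have le_up : (\sum_(0 <= t <oo) (unfinished p x0 t)%:E <=
    (upper_potential A A1 B Cu C2 [set x0]%SET)%:E)%E.
  by apply: lime_le => //; apply: nearW => N; rewrite sumEFin lee_fin.
have ge_sum N : ((\sum_(0 <= t < N) unfinished p x0 t)%:E <=
    \sum_(0 <= t <oo) (unfinished p x0 t)%:E)%E.
  by rewrite -sumEFin; apply: nneseries_lim_ge => t _ _; rewrite lee_fin unfinished_ge0.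
(* The two bounds exclude infinite values, so that the comparison takes place between reals. *)
move: le_up ge_sum; case: (\sum_(0 <= t <oo) _)%E => [s| |]; last 2 first.
- by move=> /=; rewrite leye_eq.
- by move=> _ /(_ 0%N); rewrite leeNy_eq.
rewrite lee_fin => sup sge.
have low : lower_potential A B Cl [set x0]%SET <= s.
  apply: (sum_unfinished_lim_ge hp0 hp1) => [S S0 _| |N].
  - apply: lower_potential_drift=> //.
      by rewrite /Cl lerDl.
    by rewrite /Cl [leRHS]mulrDl divfK // lerDr mulr_ge0.
  - rewrite /lower_potential finset.setCT cards0 cardsT card_ord subrr mulr0.
    by rewrite !add0r ln1 mul0r !mulr0 subr0.
  - by have := sge N; rewrite lee_fin.
have lowE : A * ln n%:R + B * ln n%:R - Cl <= lower_potential A B Cl [set x0]%SET.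
  rewrite /lower_potential card1 cardC1 subrK ln1 subr0 lerD2l lerN2.
  by rewrite ler_piMr // ler_pdivrMr // mul1r gerBl.
rewrite gE -EFinB abse_EFin lee_fin.
rewrite -/L -/A div1r -/B (mulrC (ln n%:R) _^-1) -/A ler_norml.
by apply/andP; split; lra.
Qed.
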